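(* Let $k\ge1$ be an integer. The map $\Phi:\mathcal{D}_{\mathrm{alg}}(k)\to\mathcal{D}_{\mathrm{alg}}(k)$, where $\Phi(\nu)$ is the unique element of $\mathcal{D}_{\mathrm{alg}}(k)$ with $\eta_{\Phi(\nu)}=\sum_{i=1}^k z_i(1+M_\nu)z_i$, carries $\mathcal{D}_c(k)$ into itself.
   Context: $\mathcal{D}_{\mathrm{alg}}(k)$ is the set of linear functionals $\mu$ on the algebra of non-commutative polynomials $\mathbb{C}\langle X_1,\ldots,X_k\rangle$ with $\mu(1)=1$; the joint distribution of $x_1,\ldots,x_k$ with respect to a functional $\varphi$ is the $\mu\in\mathcal{D}_{\mathrm{alg}}(k)$ with $\mu(X_{i_1}\cdots X_{i_n})=\varphi(x_{i_1}\cdots x_{i_n})$. $\mathcal{D}_c(k)\subseteq\mathcal{D}_{\mathrm{alg}}(k)$ is the set of joint distributions of $k$-tuples of selfadjoint elements in $C^*$-probability spaces (unital $C^*$-algebra $\mathcal{A}$ with a positive linear functional $\varphi$, $\varphi(1)=1$). For $\mu\in\mathcal{D}_{\mathrm{alg}}(k)$, let $M_\mu=\sum_{n\ge1}\sum_{i_1,\ldots,i_n=1}^k\mu(X_{i_1}\cdots X_{i_n})z_{i_1}\cdots z_{i_n}$ and $\eta_\mu=M_\mu(1+M_\mu)^{-1}$, formal power series in non-commuting indeterminates $z_1,\ldots,z_k$. The map $\mu\mapsto\eta_\mu$ is a bijection from $\mathcal{D}_{\mathrm{alg}}(k)$ onto the formal power series in non-commuting $z_1,\ldots,z_k$ with zero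 constant term. *)

(* Defs.v *)
From HB Require Import structures.
From mathcomp Require Import all_boot all_order all_algebra.
From mathcomp Require Import all_classical all_reals.
From mathcomp Require Import complex.
(* The notations of monalg clash with those of mathcomp.classical. *)
From mathcomp.multinomials Require Import -(notations) monalg.

Set Implicit Arguments.
Unset Strict Implicit.
Unset Printing Implicit Defensive.

Import Order.TTheory GRing.Theory Num.Theory.

Local Open Scope classical_set_scope.
Local Open Scope ring_scope.

(* A series is the family of its coefficients, indexed by words:
   [f [:: i1; ...; in]] is the coefficient of z_{i1} ... z_{in}. *)
Definition ncseries (I : Type) (K : fieldType) : Type := seq I -> K.

HB.instance Definition _ (I : Type) (K : fieldType) :=
  GRing.Zmodule.copy (ncseries I K) (seq I -> K).

Section NCSeriesRing.
Variables (I : Type) (K : fieldType).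
Local Notation S := (ncseries I K).
Implicit Types (f g h : S) (w : seq I).

Definition nc_one : S := fun w => (nilp w)%:R.

Definition nc_mul f g : S := fun w =>
  \sum_(j < (size w).+1) f (take j w) * g (drop j w).

Definition nc_shift (a : I) f : S := fun w => f (a :: w).

Lemma ncseriesD f g w : (f + g) w = f w + g w. Proof. by []. Qed.
Lemma ncseriesN f w : (- f) w = - f w. Proof. by []. Qed.
Lemma ncseries0 w : (0 : S) w = 0. Proof. by []. Qed.

Lemma nc_mul_nil f g : nc_mul f g [::] = f [::] * g [::].
Proof. by rewrite /nc_mul big_ord1. Qed.

Lemma nc_mul_cons f g a w :
  nc_mul f g (a :: w) = f [::] * g (a :: w) + nc_mul (nc_shift a f) g w.
Proof. by rewrite /nc_mul big_ord_recl. Qed.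

Lemma nc_mulDl : left_distributive nc_mul (@GRing.add S).
Proof.
move=> f g h; apply/funext => w; rewrite ncseriesD /nc_mul -big_split /=.
by apply: eq_bigr => j _; rewrite ncseriesD mulrDl.
Qed.

Lemma nc_mulDr : right_distributive nc_mul (@GRing.add S).
Proof.
move=> f g h; apply/funext => w; rewrite ncseriesD /nc_mul -big_split /=.
by apply: eq_bigr => j _; rewrite ncseriesD mulrDr.
Qed.

Lemma nc_mulZl (c : K) f g w :
  nc_mul (fun v => c * f v) g w = c * nc_mul f g w.
Proof. by rewrite /nc_mul mulr_sumr; apply: eq_bigr => j _; rewrite mulrA. Qed.

Lemma nc_mulA : associative nc_mul.
Proof.
move=> f g h; apply/funext => w; elim: w f g h => [|a w IHw] f g h.
  by rewrite !nc_mul_nil mulrA.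
have shiftM : nc_shift a (nc_mul f g) =
    (fun v => f [::] * nc_shift a g v) + nc_mul (nc_shift a f) g :> S.
  by apply/funext => v; rewrite ncseriesD /nc_shift nc_mul_cons.
rewrite !nc_mul_cons nc_mul_nil shiftM nc_mulDl ncseriesD nc_mulZl -IHw.
by rewrite mulrDr mulrA addrA.
Qed.

Lemma nc_mul1 : left_id nc_one nc_mul.
Proof.
move=> f; apply/funext => -[|a w]; first by rewrite nc_mul_nil mul1r.
rewrite nc_mul_cons mul1r /nc_mul big1 ?addr0 // => j _.
by rewrite mul0r.
Qed.

Lemma nc_mulr1 : right_id nc_one nc_mul.
Proof.
move=> f; apply/funext => w; elim: w f => [|a w IHw] f.
  by rewrite nc_mul_nil mulr1.
by rewrite nc_mul_cons mulr0 add0r IHw.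
Qed.

Lemma nc_one_neq0 : nc_one != 0 :> S.
Proof.
apply/eqP => /(congr1 (fun f : S => f [::])) /eqP.
by rewrite /nc_one /= ncseries0 oner_eq0.
Qed.

HB.instance Definition _ := GRing.Zmodule_isNzRing.Build S
  nc_mulA nc_mul1 nc_mulr1 nc_mulDl nc_mulDr nc_one_neq0.

Lemma ncseries1 w : (1 : S) w = (nilp w)%:R. Proof. by []. Qed.

Lemma ncseriesM f g w :
  (f * g) w = \sum_(j < (size w).+1) f (take j w) * g (drop j w).
Proof. by []. Qed.

Lemma ncseriesM_nil f g : (f * g) [::] = f [::] * g [::].
Proof. exact: nc_mul_nil. Qed.

Lemma ncseries_sum (J : Type) (r : seq J) (P : pred J) (F : J -> S) w :
  (\sum_(j <- r | P j) F j) w = \sum_(j <- r | P j) F j w.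
Proof. by elim/big_rec2: _ => // j x y _ <-. Qed.

Definition nc_const (c : K) : S := fun w => if w is [::] then c else 0.

Lemma nc_constM c f w : (nc_const c * f) w = c * f w.
Proof.
have -> : nc_const c = (fun v => c * (1 : S) v).
  by apply/funext => -[|a v]; rewrite ncseries1 ?mulr1 ?mulr0.
by rewrite [LHS]nc_mulZl -[nc_mul 1 f]/(1 * f) mul1r.
Qed.

Lemma nc_constMr c f w : (f * nc_const c) w = f w * c.
Proof.
elim: w f => [|a w IHw] f; first by rewrite ncseriesM_nil.
by rewrite [LHS]nc_mul_cons mulr0 add0r [LHS]IHw.
Qed.

Lemma ncseriesX_small f n w : f [::] = 0 -> (size w < n)%N -> (f ^+ n) w = 0.
Proof.
move=> f0; elim: n w => [//|n IHn] w lt_wn.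
rewrite exprS ncseriesM big1 // => -[[|j] ltj] _ /=; first by rewrite take0 f0 mul0r.
case: w lt_wn ltj => [|a w] //= lt_wn ltj.
rewrite IHn ?mulr0 // size_drop; apply: leq_ltn_trans (leq_subr _ _) _.
by rewrite -ltnS.
Qed.

(* For c := f [::] invertible, f^-1 = sum_n (1 - c^-1 f)^n c^-1; only the terms
   n <= size w contribute to the coefficient of w. *)
Definition nc_inv f : S :=
  if f [::] == 0 then f else fun w =>
    \sum_(n < (size w).+1) ((1 - nc_const (f [::])^-1 * f) ^+ n) w * (f [::])^-1.

Definition nc_unit : pred S := fun f => f [::] != 0.

Lemma nc_inv_trunc f N w : nc_unit f -> (size w < N)%N ->
  nc_inv f w = ((\sum_(n < N) (1 - nc_const (f [::])^-1 * f) ^+ n)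
                * nc_const (f [::])^-1) w.
Proof.
rewrite /nc_unit /nc_inv => fu ltwN; rewrite (negbTE fu) nc_constMr ncseries_sum.
rewrite mulr_suml (big_ord_widen N
  (fun n => ((1 - nc_const (f [::])^-1 * f) ^+ n) w * (f [::])^-1)) //=.
rewrite big_mkcond /=; apply: eq_bigr => n _; case: ltnP => // le_wn.
rewrite ncseriesX_small ?mul0r // ncseriesD ncseriesN ncseries1 nc_constM /=.
by rewrite mulVf // subrr.
Qed.

Lemma ncseriesM_ext f f' g g' w :
    (forall v, (size v <= size w)%N -> f v = f' v) ->
    (forall v, (size v <= size w)%N -> g v = g' v) ->
  (f * g) w = (f' * g') w.
Proof.
move=> ff' gg'; rewrite !ncseriesM; apply: eq_bigr => j _.
by rewrite ff' ?gg' // ?size_drop ?leq_subr // size_take_min geq_minr.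
Qed.

Lemma nc_geom_nil f : nc_unit f -> (1 - nc_const (f [::])^-1 * f) [::] = 0.
Proof.
by move=> fu; rewrite ncseriesD ncseriesN ncseries1 nc_constM mulVf // subrr.
Qed.

Lemma nc_mulVr : {in nc_unit, left_inverse 1 nc_inv *%R}.
Proof.
move=> f fu; set c := nc_const (f [::])^-1; set y := 1 - c * f.
have cf : c * f = 1 - y by rewrite /y opprB addrC subrK.
apply/funext => w.
rewrite (@ncseriesM_ext _ (\sum_(n < (size w).+1) y ^+ n * c) _ f) //; last first.
  by move=> v lev; rewrite (@nc_inv_trunc _ (size w).+1) // mulr_suml.
rewrite -mulr_suml -mulrA cf.
have -> : (\sum_(n < (size w).+1) y ^+ n) * (1 - y) = 1 - y ^+ (size w).+1.
  elim: (size w).+1 => [|n IHn]; first by rewrite big_ord0 mul0r expr0 subrr.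
  by rewrite big_ord_recr /= mulrDl IHn mulrBr mulr1 -exprSr addrA subrK.
rewrite ncseriesD ncseriesN ncseriesX_small ?subr0 //; exact: nc_geom_nil.
Qed.

Lemma nc_mulrV : {in nc_unit, right_inverse 1 nc_inv *%R}.
Proof.
move=> f fu.
have gu : nc_unit (nc_inv f).
  have := congr1 (fun g : S => g [::]) (nc_mulVr fu).
  rewrite /nc_unit ncseriesM_nil ncseries1 /= => e; apply/eqP => g0.
  by move/eqP: e; rewrite g0 mul0r eq_sym oner_eq0.
have e1 := nc_mulVr fu; have e2 := nc_mulVr gu.
by rewrite -[LHS]mul1r -{1}e2 -mulrA [nc_inv f * _]mulrA e1 mul1r e2.
Qed.

Lemma nc_unitP f g : g * f = 1 /\ f * g = 1 -> nc_unit f.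
Proof.
case=> /(congr1 (fun h : S => h [::])); rewrite ncseriesM_nil ncseries1 /= => e _.
by apply/eqP => f0; move/eqP: e; rewrite f0 mulr0 eq_sym oner_eq0.
Qed.

Lemma nc_inv_out : {in [predC nc_unit], nc_inv =1 id}.
Proof. by move=> f; rewrite inE /= /nc_unit negbK /nc_inv => ->. Qed.

HB.instance Definition _ := GRing.NzRing_hasMulInverse.Build S
  nc_mulVr nc_mulrV nc_unitP nc_inv_out.

Lemma ncseries_unitE f : (f \is a GRing.unit) = (f [::] != 0).
Proof. by []. Qed.

End NCSeriesRing.

Definition ncvar (I : eqType) (K : fieldType) (i : I) : ncseries I K :=
  fun w => (w == [:: i])%:R.

(* The Banach algebra structure is spelled out: Hierarchy Builder rejects a join
   of [GRing.Algebra] with [CompleteNormedModule], because [Num.NumDomain] is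
   already an undeclared join of a ring with a normed group. *)
HB.mixin Record isCStarAlgebra (R : realType) A & GRing.Algebra R[i] A := {
  cnorm : A -> R ;
  cnorm_eq0 : forall x : A, cnorm x = 0 -> x = 0 ;
  ler_cnormD : forall x y : A, cnorm (x + y) <= cnorm x + cnorm y ;
  cnormZ : forall (c : R[i]) (x : A),
    cnorm (c *: x) = ComplexField.Normc.normc c * cnorm x ;
  ler_cnormM : forall x y : A, cnorm (x * y) <= cnorm x * cnorm y ;
  cnorm_complete : forall u : nat -> A,
    (forall e : R, 0 < e -> exists N : nat, forall m n : nat,
       (N <= m)%N -> (N <= n)%N -> cnorm (u m - u n) < e) ->
    exists l : A, forall e : R, 0 < e -> exists N : nat, forall n : nat,
      (N <= n)%N -> cnorm (u n - l) < e ;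
  star : A -> A ;
  starK : involutive star ;
  starD : {morph star : x y / x + y} ;
  starZ : forall (c : R[i]) (x : A), star (c *: x) = c^* *: star x ;
  starM : forall x y : A, star (x * y) = star y * star x ;
  cnorm_star : forall x : A, cnorm (star x * x) = cnorm x ^+ 2
}.

#[short(type="cstarAlgType")]
HB.structure Definition CStarAlgebra (R : realType) :=
  {A of isCStarAlgebra R A & GRing.Algebra R[i] A}.

Section CStarProbability.
Variables (R : realType) (A : cstarAlgType R).

Definition selfadjoint (x : A) : Prop := star x = x.

(* In [R[i]], [0 <= z] means that z is real and nonnegative. *)
Definition positive_functional (phi : {scalar A}) : Prop :=
  forall x : A, 0 <= phi (star x * x).

Definition cstar_state (phi : {scalar A}) : Prop :=
  positive_functional phi /\ phi 1 = 1.

End CStarProbability.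

(* The monoid algebra of the free monoid on k letters. *)
Definition ncpoly (R : realType) (k : nat) := malg (fmonom 'I_k) R[i].

Definition ncX (R : realType) (k : nat) (i : 'I_k) : ncpoly R k :=
  mkmalgU (fmu i) 1.

Record Dalg (R : realType) (k : nat) := MkDalg {
  Dalg_fun :> {scalar ncpoly R k} ;
  Dalg1 : Dalg_fun 1 = 1
}.

Section Distributions.
Variables (R : realType) (k : nat).
Local Notation S := (ncseries 'I_k R[i]).
Local Notation X := (@ncX R k).
Implicit Types (mu nu : Dalg R k).

Definition is_joint_distribution (A : cstarAlgType R) (phi : {scalar A})
    (x : 'I_k -> A) mu : Prop :=
  forall w : seq 'I_k, mu (\prod_(i <- w) X i) = phi (\prod_(i <- w) x i).

Definition Dc : set (Dalg R k) := [set mu |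
  exists (A : cstarAlgType R) (phi : {scalar A}) (x : 'I_k -> A),
    [/\ cstar_state phi, forall i, selfadjoint (x i)
      & is_joint_distribution phi x mu]].

Definition Mseries mu : S := fun w =>
  if w is [::] then 0 else mu (\prod_(i <- w) X i).

Definition eta mu : S := Mseries mu * (1 + Mseries mu)^-1.

Lemma ncX_prod (w : seq 'I_k) : \prod_(i <- w) X i = mkmalgU (FMonom w) 1.
Proof.
elim: w => [|i w IHw].
  by rewrite big_nil [LHS]/1 /= /fgone; congr (mkmalgU _ 1); exact: fmoneE.
rewrite big_cons IHw [LHS]/(_ * _) /= fgmulUU mulr1; congr (mkmalgU _ 1).
by rewrite fmuE; exact: fmmulE.
Qed.

Lemma Mseries_unit mu : 1 + Mseries mu \is a GRing.unit.
Proof. by rewrite ncseries_unitE ncseriesD ncseries1 addr0 oner_eq0. Qed.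

Lemma Mseries1 mu w : (1 + Mseries mu) w = mu (\prod_(i <- w) X i).
Proof.
rewrite ncseriesD ncseries1; case: w => [|i w]; rewrite ?add0r //.
by rewrite big_nil Dalg1 /= addr0.
Qed.

Lemma Dalg_eq mu nu : (forall p, mu p = nu p) -> mu = nu.
Proof.
case: mu nu => [[f cf] f1] [[g cg] g1] /= fg.
have {}fg : f = g by apply/funext => p; exact: fg.
subst g; have ec : cf = cg.
  case: cf cg {f1 g1} => [[a] [b]] [[a'] [b']].
  by rewrite (Prop_irrelevance a a') (Prop_irrelevance b b').
subst cg; congr MkDalg; exact: Prop_irrelevance.
Qed.

Lemma Mseries_inj mu nu : Mseries mu = Mseries nu -> mu = nu.
Proof.
move=> eM; apply: Dalg_eq => p; rewrite [p]monalgE !raddf_sum /=.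
apply: eq_bigr => -[w] _.
have -> : mkmalgU (FMonom w) (mcoeff (FMonom w) p) =
    mcoeff (FMonom w) p *: \prod_(i <- w) X i :> ncpoly R k.
  rewrite ncX_prod; apply/malgP => v.
  by rewrite mcoeffZ !mcoeffU mulr_natr.
by rewrite !linearZ -!Mseries1 eM.
Qed.

Lemma Mseries_surj (f : S) : f [::] = 0 -> exists mu, Mseries mu = f.
Proof.
move=> f0; pose h (m : fmonom 'I_k) : R[i] := (1 + f) (fmonom_val m).
pose mu (p : ncpoly R k) : R[i] := mmap idfun h p.
have muZ : scalable_for *%R mu.
  move=> c p; rewrite /mu (mmapEw (msuppZ_le _ _)) mmapE mulr_sumr.
  by apply: eq_bigr => m _; rewrite /= mcoeffZ mulrA.
have muU w : mu (mkmalgU (FMonom w) 1) = (1 + f) w.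
  by rewrite /mu mmapU /= mul1r.
have muL : linear_for *%R mu.
  by move=> c p q; rewrite -muZ /mu raddfD.
pose mul : {scalar ncpoly R k} :=
  HB.pack mu (GRing.isLinear.Build R[i] (ncpoly R k) R[i] *%R mu muL).
have mu1 : mul 1 = 1.
  have -> : 1 = mkmalgU (FMonom [::]) 1 :> ncpoly R k.
    by rewrite -ncX_prod big_nil.
  by rewrite /= muU ncseriesD ncseries1 f0 addr0.
exists (MkDalg mu1); apply/funext => -[|i w] /=; first by rewrite f0.
by rewrite ncX_prod muU ncseriesD ncseries1 add0r.
Qed.

Lemma eta_nil mu : eta mu [::] = 0.
Proof. by rewrite /eta ncseriesM_nil mul0r. Qed.

Lemma eta_Mseries mu : (1 - eta mu) * (1 + Mseries mu) = 1.
Proof.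
by rewrite mulrBl mul1r /eta mulrVK ?Mseries_unit // addrK.
Qed.

Lemma eta_inj : injective eta.
Proof.
move=> mu nu e; apply: Mseries_inj; apply: (addrI 1).
have u : 1 - eta mu \is a GRing.unit.
  by rewrite ncseries_unitE ncseriesD ncseriesN eta_nil ncseries1 subr0 oner_eq0.
by apply: (mulrI u); rewrite eta_Mseries e eta_Mseries.
Qed.

Lemma eta_surj (f : S) : f [::] = 0 -> exists mu, eta mu = f.
Proof.
move=> f0; have fu : 1 - f \is a GRing.unit.
  by rewrite ncseries_unitE ncseriesD ncseriesN ncseries1 f0 subr0 oner_eq0.
have [|mu Mmu] := @Mseries_surj (f * (1 - f)^-1).
  by rewrite ncseriesM_nil f0 mul0r.
exists mu; rewrite /eta Mmu.
have -> : 1 + f * (1 - f)^-1 = (1 - f)^-1.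
  by rewrite -{1}(divrr fu) -mulrDl subrK mul1r.
by rewrite invrK mulrVK.
Qed.

Lemma eta_bij (f : S) : f [::] = 0 -> exists! mu, eta mu = f.
Proof.
move=> f0; have [mu emu] := eta_surj f0.
by exists mu; split=> [|nu enu]; [exact: emu | apply: eta_inj; rewrite emu enu].
Qed.

Definition Phi_series nu : S :=
  \sum_(i < k) ncvar R[i] i * (1 + Mseries nu) * ncvar R[i] i.

Lemma Phi_series_nil nu : Phi_series nu [::] = 0.
Proof.
rewrite /Phi_series ncseries_sum big1 // => i _.
by rewrite !ncseriesM_nil mulr0.
Qed.

Definition Phi nu : Dalg R k := projT1 (cid (eta_bij (Phi_series_nil nu))).

Lemma eta_Phi nu : eta (Phi nu) = Phi_series nu.
Proof. by rewrite /Phi; case: cid => mu []. Qed.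

Lemma Phi_unique nu mu : eta mu = Phi_series nu -> mu = Phi nu.
Proof. by rewrite -eta_Phi => /eta_inj. Qed.

End Distributions.

(* Main.v *)
(* Let (A, phi) and x_1, ..., x_k realise nu. On V = C + A^k, with the
   semi-inner product induced by (a, b) |-> phi (b^* a) and with the vacuum
   vector (1, 0), put
     T_j (c, b) = (phi (b_j), (x_j b_i + delta_ij c 1)_i).
   The T_j are symmetric and bounded, and splitting a word at the first return
   to the vacuum shows that the vacuum moments m of (T_j) satisfy
     m = 1 + (sum_i z_i (1 + M_nu) z_i) m,
   which is the equation characterising 1 + M_(Phi nu).

   V is not complete, and instead of completing it we compress, for each N, the
   T_j to the span of the vectors T_w vacuum with |w| <= N, where Gram-Schmidt
   turns them into matrices; this does not change the moments of words of length
   at most N. Bounded sequences of matrices form a C*-algebra, in which the T_j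
   thus give selfadjoint elements, and the limit of the vacuum states along an
   ultrafilter is a state with the required moments. *)
From HB Require Import structures.
Require Import Defs.
From mathcomp Require Import all_boot all_order all_algebra.
From mathcomp Require Import all_classical all_reals.
From mathcomp Require Import complex topology normedtype sequences.
From mathcomp Require Import ring.

Set Implicit Arguments.
Unset Strict Implicit.
Unset Printing Implicit Defensive.

Import numFieldNormedType.Exports.
Import Order.TTheory GRing.Theory Num.Theory.

Local Open Scope ring_scope.

(** * Semi-inner products *)

Record semi_inner (C : numClosedFieldType) (V : lmodType C)
    (dot : V -> V -> C) : Prop := {
  dot_linear : forall a u v w, dot (a *: u + v) w = a * dot u w + dot v w ;
  dotC : forall u v, dot u v = (dot v u)^* ;
  dot_ge0 : forall u, 0 <= dot u u }.

Section SemiInner.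
Variables (C : numClosedFieldType) (V : lmodType C) (dot : V -> V -> C).
Hypothesis dotP : semi_inner dot.

Lemma dotDl u v w : dot (u + v) w = dot u w + dot v w.
Proof. by rewrite -[u]scale1r (dot_linear dotP) mul1r scale1r. Qed.

Lemma dot0l w : dot 0 w = 0.
Proof. by apply: (addrI (dot 0 w)); rewrite -dotDl !addr0. Qed.

Lemma dotZl a u w : dot (a *: u) w = a * dot u w.
Proof. by rewrite -[a *: u]addr0 (dot_linear dotP) dot0l addr0. Qed.

Lemma dotBl u v w : dot (u - v) w = dot u w - dot v w.
Proof. by rewrite dotDl -scaleN1r dotZl mulN1r. Qed.

Lemma dot_suml (I : Type) (r : seq I) (F : I -> V) w :
  dot (\sum_(i <- r) F i) w = \sum_(i <- r) dot (F i) w.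
Proof. by apply: (big_morph (dot^~ w)) => [u v|]; rewrite ?dotDl ?dot0l. Qed.

Lemma dotDr u v w : dot w (u + v) = dot w u + dot w v.
Proof. by rewrite !(dotC dotP w) dotDl rmorphD. Qed.

Lemma dot0r w : dot w 0 = 0.
Proof. by rewrite (dotC dotP) dot0l rmorph0. Qed.

Lemma dotZr a u w : dot w (a *: u) = a^* * dot w u.
Proof. by rewrite !(dotC dotP w) dotZl rmorphM. Qed.

Lemma dotBr u v w : dot w (u - v) = dot w u - dot w v.
Proof. by rewrite !(dotC dotP w) dotBl rmorphB. Qed.

Lemma dot_sumr (I : Type) (r : seq I) (F : I -> V) w :
  dot w (\sum_(i <- r) F i) = \sum_(i <- r) dot w (F i).
Proof. by apply: (big_morph (dot w)) => [u v|]; rewrite ?dotDr ?dot0r. Qed.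

Lemma dot_conj u : (dot u u)^* = dot u u.
Proof. by rewrite -(dotC dotP). Qed.

(** Expanding [dot w w >= 0] at [w = s *: u - t *: v] with real [s] gives the inequality [Q]. For
    [dot v v != 0] take [s = dot v v] and [t = dot u v], then divide by [dot v v]. As [dot] may be
    degenerate, [dot v v = 0] is a separate case. *)
Lemma cauchy_schwarz u v : `|dot u v| ^+ 2 <= dot u u * dot v v.
Proof.
set a := dot u u; set b := dot v v; set c := dot u v.
have a0 : 0 <= a by exact: dot_ge0.
have b0 : 0 <= b by exact: dot_ge0.
have Q s t : s^* = s ->
    0 <= s ^+ 2 * a - s * (t^* * c) - s * (t * c^*) + `|t| ^+ 2 * b.
  move=> sR; have := dot_ge0 dotP (s *: u - t *: v).
  rewrite dotBl !dotBr !dotZl !dotZr (dotC dotP v u) -/a -/b -/c sR normCK.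
  by congr (0 <= _); ring.
have [bE0|bN0] := eqVneq b 0; last first.
  have bR : b^* = b by exact: dot_conj.
  have := Q b c bR; rewrite [c^* * c]mulrC -normCK.
  have -> : b ^+ 2 * a - b * `|c| ^+ 2 - b * `|c| ^+ 2 + `|c| ^+ 2 * b =
    b * (a * b - `|c| ^+ 2) by ring.
  by rewrite pmulr_rge0 ?subr_ge0 // lt_def bN0.
rewrite bE0 mulr0; have [->|cN0] := eqVneq c 0; first by rewrite normr0 expr0n.
have n0 : `|c| ^+ 2 != 0 by rewrite expf_neq0 // normr_eq0.
(* With [b = 0], the instance [s = 1], [t = x * c] of [Q] reads [0 <= a - 2 * x * |c|^2]. This [x]
   makes the right-hand side [-1], a contradiction. *)
set x := (a + 1) / (2 * `|c| ^+ 2).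
have xR : x^* = x.
  apply: conj_Creal; apply: ger0_real.
  by rewrite divr_ge0 ?addr_ge0 ?ler01 // mulr_ge0 ?ler0n // exprn_ge0.
have := Q 1 (x * c) (rmorph1 _).
have -> : (x * c)^* = x * c^* by rewrite -[in RHS]xR rmorphM.
rewrite bE0 mulr0 addr0 expr1n !mul1r -!(mulrA x) [c^* * c]mulrC -normCK.
have -> : a - x * `|c| ^+ 2 - x * `|c| ^+ 2 = - 1.
  by rewrite /x; field; rewrite normr_eq0.
by rewrite oppr_ge0 ler10.
Qed.

(** Parallelogram law: the difference of the two sides is [dot (u - v) (u - v)]. *)
Lemma dotDD_le u v : dot (u + v) (u + v) <= 2 * (dot u u + dot v v).
Proof.
rewrite -subr_ge0; have := dot_ge0 dotP (u - v).
rewrite dotBl !dotBr dotDl !dotDr.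
set a := dot u u; set b := dot u v; set c := dot v u; set e := dot v v.
by congr (0 <= _); ring.
Qed.

Definition seminorm u : C := sqrtC (dot u u).

Lemma seminorm_ge0 u : 0 <= seminorm u.
Proof. by rewrite sqrtC_ge0 dot_ge0. Qed.

Lemma seminorm_sqr u : seminorm u ^+ 2 = dot u u.
Proof. exact: sqrtCK. Qed.

Lemma ler_norm_dot u v : `|dot u v| <= seminorm u * seminorm v.
Proof.
rewrite -(ler_pXn2r (n := 2)) ?nnegrE ?mulr_ge0 ?seminorm_ge0 //.
by rewrite exprMn !seminorm_sqr; exact: cauchy_schwarz.
Qed.

Lemma ler_seminormD u v : seminorm (u + v) <= seminorm u + seminorm v.
Proof.
rewrite -(ler_pXn2r (n := 2)) ?nnegrE ?addr_ge0 ?seminorm_ge0 //.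
rewrite sqrrD !seminorm_sqr dotDl !dotDr addrA lerD2r -addrA lerD2l.
rewrite (dotC dotP v u); set z := dot u v.
have zR : z + z^* \is Num.real by rewrite CrealE rmorphD /= conjCK addrC.
apply: le_trans (real_ler_norm zR) _; apply: le_trans (ler_normD _ _) _.
by rewrite norm_conjC mulr2n lerD // ler_norm_dot.
Qed.

Lemma seminormZ a u : seminorm (a *: u) = `|a| * seminorm u.
Proof.
rewrite /seminorm dotZl dotZr mulrA -normCK rootCMl ?exprn_ge0 //.
by rewrite sqrCK.
Qed.

Lemma seminorm0 : seminorm 0 = 0.
Proof. by rewrite /seminorm dot0l sqrtC0. Qed.

Lemma ler_seminorm_sum (I : Type) (r : seq I) (F : I -> V) :
  seminorm (\sum_(i <- r) F i) <= \sum_(i <- r) seminorm (F i).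
Proof.
elim: r => [|i r IHr]; first by rewrite !big_nil seminorm0.
by rewrite !big_cons (le_trans (ler_seminormD _ _)) // lerD2l.
Qed.

Lemma dot_null u v : dot u u = 0 -> dot u v = 0.
Proof.
move=> u0; have := cauchy_schwarz u v; rewrite u0 mul0r => le0.
have : `|dot u v| ^+ 2 == 0 by rewrite eq_le le0 exprn_ge0.
by rewrite expf_eq0 /= normr_eq0 => /eqP.
Qed.

(** The expansion of [w] along [es] is correct up to a null vector: since [dot] is only
    semi-definite, the identity is tested against every [u]. *)
Definition resolves (es : seq V) (w : V) :=
  forall u, dot w u = \sum_(e <- es) dot w e * dot e u.

(* Gram-Schmidt in the semi-definite case. Orthonormality of [es] is replaced
   by the weaker, more convenient condition that [es] resolves itself. *)
Lemma gram_schmidt (s : seq V) : exists es : seq V,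
  (forall w, w \in s -> resolves es w) /\ (forall e, e \in es -> resolves es e).
Proof.
elim: s => [|v s [es [sP eP]]]; first by exists [::].
set r := v - \sum_(e <- es) dot v e *: e.
have vE u : dot v u = dot r u + \sum_(e <- es) dot v e * dot e u.
  rewrite /r dotBl dot_suml; under [X in _ - X]eq_bigr do rewrite dotZl.
  by rewrite subrK.
have er e : e \in es -> dot e r = 0.
  move=> ees; rewrite /r dotBr dot_sumr (eP _ ees v); apply/eqP.
  rewrite subr_eq0; apply/eqP; apply: eq_bigr => f _.
  by rewrite dotZr -(dotC dotP) mulrC.
have sr w : w \in s -> dot w r = 0.
  move=> /sP ->; rewrite big_seq big1 // => e /er ->; exact: mulr0.
(* A residual of zero seminorm is orthogonal to everything, so [es] already resolves [v]. Otherwise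
   the residual is normalised and added to [es]. *)
have [r0|rN0] := eqVneq (dot r r) 0.
  exists es; split => // w; rewrite inE => /orP[/eqP->|/sP //] u.
  by rewrite vE dot_null ?add0r.
pose p := (sqrtC (dot r r))^-1; pose f := p *: r.
have p2 : p * p = (dot r r)^-1 by rewrite -invfM -expr2 sqrtCK.
have pR : p^* = p.
  by apply: conj_Creal; rewrite rpredV ger0_real // sqrtC_ge0 dot_ge0.
have fE u : dot f u = p * dot r u by exact: dotZl.
have rf u w : dot w f * dot f u = (dot r r)^-1 * (dot w r * dot r u).
  by rewrite /f dotZr dotZl pR -p2; ring.
have ef w : dot w r = 0 -> resolves es w -> resolves (f :: es) w.
  by move=> wr0 wP u; rewrite big_cons rf wr0 mul0r mulr0 add0r wP.
exists (f :: es); split=> w; rewrite inE => /orP[/eqP->|ws].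
- move=> u; rewrite big_cons rf vE; congr (_ + _).
  rewrite vE [X in _ + X]big_seq big1 ?addr0 ?mulrA ?mulVf ?mul1r // => e /er->.
  exact: mulr0.
- by apply: ef; [exact: sr | exact: sP].
- move=> u; rewrite big_cons rf [X in _ + X]big_seq big1 ?addr0.
    by rewrite !fE; field.
  move=> e ees; rewrite fE (dotC dotP r) er // rmorph0.
  by rewrite mulr0 mul0r.
- by apply: ef; [exact: er | exact: eP].
Qed.

(** For the expansion [p] of [v] along [es], both [dot v p] and [dot p p] equal the sum on the left,
    so [dot (v - p) (v - p) >= 0] is the claim. *)
Lemma bessel (es : seq V) v : (forall e, e \in es -> resolves es e) ->
  \sum_(e <- es) `|dot v e| ^+ 2 <= dot v v.
Proof.
move=> eP; set S := \sum_(e <- es) _; pose p := \sum_(e <- es) dot v e *: e.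
have vp : dot v p = S.
  by rewrite dot_sumr; apply: eq_bigr => e _; rewrite dotZr mulrC normCK.
have pp : dot p p = S.
  rewrite {1}/p dot_suml /S big_seq [RHS]big_seq; apply: eq_bigr => e ees.
  rewrite dotZl normCK -(dotC dotP); congr (_ * _).
  rewrite dot_sumr (eP _ ees v); apply: eq_bigr => f _.
  by rewrite dotZr -(dotC dotP) mulrC.
have SR : S^* = S by rewrite -pp dot_conj.
have := dot_ge0 dotP (v - p).
by rewrite dotBl !dotBr (dotC dotP p v) vp SR pp subrr subr0 subr_ge0.
Qed.

End SemiInner.

(** * Products of algebras *)

(** Completeness of [R] is applied to the real and the imaginary part, two maps [g] that respect
    differences and are dominated by the modulus. *)
Lemma complex_cauchy_cvg (R : realType) (u : nat -> R[i]) :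
  (forall e : R, 0 < e -> exists N, forall m n, (N <= m)%N -> (N <= n)%N ->
     `|u m - u n| < e%:C%C) ->
  exists l, forall e : R, 0 < e -> exists N, forall n, (N <= n)%N ->
     `|u n - l| < e%:C%C.
Proof.
move=> uC.
have real_part (g : R[i] -> R) : (forall x y, g (x - y) = g x - g y) ->
    (forall z, `|g z|%:C%C <= `|z|) ->
    exists l, forall e : R, 0 < e -> exists N, forall n, (N <= n)%N ->
      `|g (u n) - l| < e.
  move=> gB gn; suff : cvg ((g \o u) @ \oo)%classic.
    move=> /cvg_ex[l gl]; exists l => e e0.
    have /cvgrPdist_lt/(_ e e0)[N _ NP] := gl.
    by exists N => n /NP; rewrite distrC.
  apply/cauchy_cvgP/cauchy_exP => e e0; have [N NP] := uC e e0.
  exists (g (u N)), N => // n /= Nn; rewrite /ball /= -ltcR -gB.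
  by apply: le_lt_trans (gn _) _; exact: NP.
have [|z|a aP] := real_part (@complex.Re R).
- by case=> ? ? [].
- by rewrite normc_def lecR -sqrtr_sqr ler_wsqrtr // lerDl sqr_ge0.
have [|z|b bP] := real_part (@complex.Im R).
- by case=> ? ? [].
- by rewrite normc_def lecR -sqrtr_sqr ler_wsqrtr // lerDr sqr_ge0.
exists (a +i* b)%C => e e0.
have [N NP] := aP (e / 2) (divr_gt0 e0 (ltr0Sn _ _)).
have [M MP] := bP (e / 2) (divr_gt0 e0 (ltr0Sn _ _)).
exists (maxn N M) => n; rewrite geq_max => /andP[/NP na /MP nb].
have -> : u n - (a +i* b)%C =
    (complex.Re (u n) - a)%:C%C + 'i%C * (complex.Im (u n) - b)%:C%C.
  by case: (u n) => x y; simpc.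
apply: le_lt_trans (ler_normD _ _) _; rewrite normrM.
rewrite [`|'i%C|]normc_def /= expr0n expr1n add0r sqrtr1 mul1r.
have -> : e%:C%C = (e / 2)%:C%C + (e / 2)%:C%C by rewrite -rmorphD -splitr.
by apply: ltrD; rewrite normc_def /= expr0n addr0 sqrtr_sqr ltcR.
Qed.

Definition algprod (K : fieldType) (A : nat -> algType K) : Type :=
  forall n, A n.

Section SequenceProduct.
Variables (K : fieldType) (A : nat -> algType K).
Local Notation P := (algprod A).
Implicit Types (x y z : P) (a b : K).

HB.instance Definition _ := gen_eqMixin P.
HB.instance Definition _ := gen_choiceMixin P.

Lemma algprod_ext x y : (forall n, x n = y n) -> x = y.
Proof. exact: functional_extensionality_dep. Qed.

Let zero : P := fun=> 0.
Let add x y : P := fun n => x n + y n.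
Let opp x : P := fun n => - x n.

Let addA : associative add.
Proof. by move=> x y z; apply: algprod_ext => n; exact: addrA. Qed.
Let addC : commutative add.
Proof. by move=> x y; apply: algprod_ext => n; exact: addrC. Qed.
Let add0 : left_id zero add.
Proof. by move=> x; apply: algprod_ext => n; exact: add0r. Qed.
Let addN : left_inverse zero opp add.
Proof. by move=> x; apply: algprod_ext => n; exact: addNr. Qed.
HB.instance Definition _ := GRing.isZmodule.Build P addA addC add0 addN.

Let one : P := fun=> 1.
Let mul x y : P := fun n => x n * y n.

Let mulA : associative mul.
Proof. by move=> x y z; apply: algprod_ext => n; exact: mulrA. Qed.
Let mul1 : left_id one mul.
Proof. by move=> x; apply: algprod_ext => n; exact: mul1r. Qed.
Let mulr1 : right_id one mul.
Proof. by move=> x; apply: algprod_ext => n; exact: mulr1. Qed.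
Let mulDl : left_distributive mul +%R.
Proof. by move=> x y z; apply: algprod_ext => n; exact: mulrDl. Qed.
Let mulDr : right_distributive mul +%R.
Proof. by move=> x y z; apply: algprod_ext => n; exact: mulrDr. Qed.
Let one_neq0 : one != 0.
Proof. by apply/eqP => /(congr1 (@^~ 0%N))/eqP; rewrite oner_eq0. Qed.
HB.instance Definition _ :=
  GRing.Zmodule_isNzRing.Build P mulA mul1 mulr1 mulDl mulDr one_neq0.

Let scale a x : P := fun n => a *: x n.

Let scaleA a b x : scale a (scale b x) = scale (a * b) x.
Proof. by apply: algprod_ext => n; exact: scalerA. Qed.
Let scale1 : left_id 1 scale.
Proof. by move=> x; apply: algprod_ext => n; exact: scale1r. Qed.
Let scaleDr : right_distributive scale +%R.
Proof. by move=> a x y; apply: algprod_ext => n; exact: scalerDr. Qed.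
Let scaleDl x : {morph scale^~ x : a b / a + b}.
Proof. by move=> a b; apply: algprod_ext => n; exact: scalerDl. Qed.
HB.instance Definition _ :=
  GRing.Zmodule_isLmodule.Build K P scaleA scale1 scaleDr scaleDl.

Let scaleAl a x y : a *: (x * y) = (a *: x) * y.
Proof. by apply: algprod_ext => n; exact: scalerAl. Qed.
HB.instance Definition _ := GRing.Lmodule_isLalgebra.Build K P scaleAl.

Let scaleAr a x y : a *: (x * y) = x * (a *: y).
Proof. by apply: algprod_ext => n; exact: scalerAr. Qed.
HB.instance Definition _ := GRing.Lalgebra_isAlgebra.Build K P scaleAr.

Lemma algprod0 n : (0 : P) n = 0. Proof. by []. Qed.
Lemma algprodD x y n : (x + y) n = x n + y n. Proof. by []. Qed.
Lemma algprodN x n : (- x) n = - x n. Proof. by []. Qed.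
Lemma algprodM x y n : (x * y) n = x n * y n. Proof. by []. Qed.
Lemma algprodZ a x n : (a *: x) n = a *: x n. Proof. by []. Qed.

End SequenceProduct.

(** * Bounded sequences of matrices *)

Section ColumnVectors.
Variable C : numClosedFieldType.

Definition vdot n (u v : 'cV[C]_n) : C := \sum_i u i 0 * (v i 0)^*.

Lemma vdotP n : semi_inner (@vdot n).
Proof.
split=> [a u v w|u v|u].
- rewrite mulr_sumr -big_split; apply: eq_bigr => i _.
  by rewrite !mxE mulrDl mulrA.
- by rewrite rmorph_sum; apply: eq_bigr => i _; rewrite rmorphM /= conjCK mulrC.
- by apply: sumr_ge0 => i _; rewrite -normCK exprn_ge0.
Qed.

Arguments vdotP {n}.

Definition vnorm n (u : 'cV[C]_n) : C := seminorm (@vdot n) u.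

Definition adjmx m n (A : 'M[C]_(m, n)) : 'M[C]_(n, m) := map_mx Num.conj A^T.

Lemma vdot_adj m n (A : 'M[C]_(m, n)) u v :
  vdot (A *m u) v = vdot u (adjmx A *m v).
Proof.
rewrite /vdot; under eq_bigr do rewrite mxE mulr_suml.
rewrite exchange_big; apply: eq_bigr => j _; rewrite mxE rmorph_sum mulr_sumr.
apply: eq_bigr => i _; rewrite !mxE rmorphM /= conjCK; ring.
Qed.

Lemma adjmxK m n : cancel (@adjmx m n) (@adjmx n m).
Proof. by move=> A; apply/matrixP => i j; rewrite !mxE conjCK. Qed.

Lemma vnorm_ge0 n (v : 'cV[C]_n) : 0 <= vnorm v.
Proof. exact: (seminorm_ge0 vdotP). Qed.

Lemma ler_vnormD n (u v : 'cV[C]_n) : vnorm (u + v) <= vnorm u + vnorm v.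
Proof. exact: (ler_seminormD vdotP). Qed.

Lemma vnormZ n a (v : 'cV[C]_n) : vnorm (a *: v) = `|a| * vnorm v.
Proof. exact: (seminormZ vdotP). Qed.

Lemma ler_entry_vnorm n (u : 'cV[C]_n) i : `|u i 0| <= vnorm u.
Proof.
rewrite -(ler_pXn2r (n := 2)) ?nnegrE ?seminorm_ge0 //; last exact: vdotP.
rewrite seminorm_sqr /vdot (bigD1 i) //= -normCK lerDl sumr_ge0 // => j _.
by rewrite -normCK exprn_ge0.
Qed.

Lemma vnorm_delta n (i : 'I_n) : vnorm (delta_mx i 0) = 1.
Proof.
rewrite /vnorm /seminorm /vdot (bigD1 i) //= big1 => [|j ji].
  by rewrite !mxE !eqxx mul1r addr0 rmorph1 sqrtC1.
by rewrite !mxE (negbTE ji) mul0r.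
Qed.

Lemma ler_vnorm_sum n (u : 'cV[C]_n) : vnorm u <= \sum_i `|u i 0|.
Proof.
have uE : u = \sum_i u i 0 *: delta_mx i 0.
  rewrite {1}[u]matrix_sum_delta; apply: eq_bigr => i _; rewrite big_ord1.
  by rewrite [ord0]ord1.
rewrite {1}uE (le_trans (ler_seminorm_sum vdotP _ _)) //.
apply: ler_sum => i _; rewrite (seminormZ vdotP).
by rewrite -/(vnorm _) vnorm_delta mulr1.
Qed.

End ColumnVectors.

Arguments vdotP {C n}.

(** * Operator norm on sequences of matrices: C*-identity and completeness *)

Section BoundedSequences.
Variables (R : realType) (d : nat -> nat).
Local Notation C := R[i].
Local Notation normc := ComplexField.Normc.normc.

Definition matseq := algprod (fun n => 'M[C]_((d n).+1)).
HB.instance Definition _ := GRing.Algebra.on matseq.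
Implicit Types (S T : matseq) (K L : R).

(** One bound for all indices [n]. The clause [0 <= K] bounds from below the set whose infimum is
    [opnorm]. *)
Definition opbound K T := 0 <= K /\
  forall n (v : 'cV_((d n).+1)), vnorm (T n *m v) <= K%:C%C * vnorm v.

Lemma vnorm_real n (v : 'cV[C]_n) : exists2 r : R, 0 <= r & vnorm v = r%:C%C.
Proof.
have v0 : 0 <= vnorm v by exact: vnorm_ge0.
exists (complex.Re (vnorm v)); last by rewrite RRe_real ?ger0_real.
by rewrite -ler0c RRe_real ?ger0_real.
Qed.

Lemma opboundD K L S T :
  opbound K S -> opbound L T -> opbound (K + L) (S + T).
Proof.
move=> [K0 KS] [L0 LT]; split=> [|n v]; first exact: addr_ge0.
rewrite algprodD mulmxDl (le_trans (ler_vnormD _ _)) //.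
by rewrite rmorphD mulrDl lerD.
Qed.

Lemma opboundZ a K T : opbound K T -> opbound (normc a * K) (a *: T).
Proof.
move=> [K0 KT]; split=> [|n v].
  by rewrite mulr_ge0 // -ler0c -[_%:C%C]/`|a| normr_ge0.
by rewrite algprodZ -scalemxAl vnormZ rmorphM -mulrA ler_wpM2l.
Qed.

Lemma opboundM K L S T :
  opbound K S -> opbound L T -> opbound (K * L) (S * T).
Proof.
move=> [K0 KS] [L0 LT]; split=> [|n v]; first exact: mulr_ge0.
rewrite algprodM -[S n * T n]/(S n *m T n) -mulmxA (le_trans (KS _ _)) //.
by rewrite rmorphM -mulrA ler_wpM2l // ler0c.
Qed.

Lemma opbound0 : opbound 0 0.
Proof.
by split=> // n v; rewrite mul0r algprod0 mul0mx /vnorm (seminorm0 vdotP).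
Qed.

Lemma opbound1 : opbound 1 1.
Proof. by split=> // n v; rewrite mul1r mul1mx. Qed.

Definition adjseq T : matseq := fun n => adjmx (T n).

(** At each index, [|T v|^2 = <v, T^* T v> <= |v| * K * |v|] by Cauchy-Schwarz. *)
Lemma opbound_cstar K T : opbound K (adjseq T * T) ->
  opbound (Num.sqrt K) T.
Proof.
move=> [K0 KT]; split=> [|n v]; first exact: sqrtr_ge0.
rewrite -(ler_pXn2r (n := 2)) ?nnegrE ?mulr_ge0 ?vnorm_ge0 ?ler0c ?sqrtr_ge0 //.
rewrite exprMn -rmorphXn sqr_sqrtr // {1}/vnorm seminorm_sqr vdot_adj mulmxA.
rewrite -[leLHS]ger0_norm; last first.
  by rewrite -mulmxA -vdot_adj; exact: dot_ge0 vdotP _.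
rewrite (le_trans (ler_norm_dot vdotP _ _)) // -!/(vnorm _).
rewrite expr2 mulrCA mulrA [leLHS]mulrC ler_wpM2r ?vnorm_ge0 //.
by rewrite -[leRHS]mulrC KT.
Qed.

(** At each index, [|T^* v|^2 = <v, T T^* v> <= |v| * K * |T^* v|], and [|T^* v|] cancels when it is
    nonzero. *)
Lemma opbound_adj K T : opbound K T -> opbound K (adjseq T).
Proof.
move=> [K0 KT]; split=> // n v.
have [->|nz] := eqVneq (vnorm (adjmx (T n) *m v)) 0.
  by rewrite mulr_ge0 ?vnorm_ge0 ?ler0c.
have nP : 0 < vnorm (adjmx (T n) *m v) by rewrite lt_def nz vnorm_ge0.
rewrite -(ler_pM2r nP) -expr2 seminorm_sqr vdot_adj adjmxK.
rewrite -[leLHS]ger0_norm; last first.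
  by rewrite -{1}[T n]adjmxK -vdot_adj; exact: dot_ge0 vdotP _.
rewrite (le_trans (ler_norm_dot vdotP _ _)) // -!/(vnorm _).
by rewrite mulrC mulrAC ler_wpM2r ?vnorm_ge0.
Qed.

Definition bounded_seq : {pred matseq} := fun T => `[< exists K, opbound K T >].

Lemma bounded_subalg : GRing.subalg_closed bounded_seq.
Proof.
split; first by apply/asboolP; exists 1; exact: opbound1.
  move=> a S T /asboolP[K KS] /asboolP[L LT]; apply/asboolP.
  by exists (normc a * K + L); apply: opboundD => //; exact: opboundZ.
move=> S T /asboolP[K KS] /asboolP[L LT]; apply/asboolP.
by exists (K * L); exact: opboundM.
Qed.

(** Off [bounded_seq] the set is empty and the infimum is a default value, hence the membership
    hypotheses in the lemmas below. *)
Definition opnorm T : R := inf [set K | opbound K T].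

Lemma opnorm_le K T : opbound K T -> opnorm T <= K.
Proof. by move=> KT; apply: ge_inf => //; exists 0 => L []. Qed.

(** The infimum is attained: for [v] of norm [r > 0] the quotient [s / r] is a lower bound of all
    bounds. For [r = 0] any one bound forces [s <= 0]. *)
Lemma opnorm_bound T : T \in bounded_seq -> opbound (opnorm T) T.
Proof.
move=> /asboolP[K0 K0T]; split=> [|n v].
  by apply: lb_le_inf => [|L []//]; exists K0.
have [r r0 rE] := vnorm_real v; have [s s0 sE] := vnorm_real (T n *m v).
rewrite rE sE -rmorphM lecR; have [rZ|rN] := eqVneq r 0.
  by have := K0T.2 n v; rewrite rE sE rZ !mulr0 lecR.
have rP : 0 < r by rewrite lt_def rN.
rewrite -ler_pdivrMr //; apply: lb_le_inf => [|L [L0 /(_ n v)]].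
  by exists K0.
by rewrite rE sE -rmorphM lecR ler_pdivrMr.
Qed.

Lemma opnorm0 : opnorm 0 = 0.
Proof.
apply/eqP; rewrite eq_le opnorm_le; last exact: opbound0.
suff /opnorm_bound[] : (0 : matseq) \in bounded_seq by [].
by apply/asboolP; exists 0; exact: opbound0.
Qed.

Lemma opnorm_ge0 T : T \in bounded_seq -> 0 <= opnorm T.
Proof. by case/opnorm_bound. Qed.

Lemma ler_entry_opbound K T n i j : opbound K T -> `|T n i j| <= K%:C%C.
Proof.
move=> [K0 KT]; have := KT n (delta_mx j 0); rewrite vnorm_delta mulr1.
apply: le_trans; rewrite -colE; have := ler_entry_vnorm (col j (T n)) i.
by rewrite mxE.
Qed.

Lemma opnorm0_eq0 T : T \in bounded_seq -> opnorm T = 0 -> T = 0.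
Proof.
move=> Tb T0; have := opnorm_bound Tb; rewrite T0 => bT.
apply: algprod_ext => n; apply/matrixP => i j; rewrite mxE; apply/eqP.
by rewrite -normr_le0 (ler_entry_opbound _ _ bT).
Qed.

Lemma bounded_seqZ a T : T \in bounded_seq -> a *: T \in bounded_seq.
Proof.
by move=> /asboolP[K KT]; apply/asboolP; eexists; exact: opboundZ KT.
Qed.

(** One inequality is [opboundZ]; the other is the same inequality for [a^-1] and [a *: T]. *)
Lemma opnormZ a T : T \in bounded_seq -> opnorm (a *: T) = normc a * opnorm T.
Proof.
move=> Tb.
have le b S : S \in bounded_seq -> opnorm (b *: S) <= normc b * opnorm S.
  by move=> Sb; apply/opnorm_le/opboundZ/opnorm_bound.
apply/eqP; rewrite eq_le le //=; have [->|a0] := eqVneq a 0.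
  by rewrite scale0r opnorm0 ComplexField.Normc.normc0 mul0r.
have n0 : 0 < normc a by rewrite -ltcR (_ : (normc a)%:C%C = `|a|) // normr_gt0.
have := le a^-1 _ (bounded_seqZ a Tb).
by rewrite scalerA mulVf // scale1r ComplexField.Normc.normcV ler_pdivlMl.
Qed.

Lemma bounded_adjseq T : T \in bounded_seq -> adjseq T \in bounded_seq.
Proof.
by move=> /asboolP[K KT]; apply/asboolP; exists K; exact: opbound_adj.
Qed.

Lemma opnorm_cstar T : T \in bounded_seq ->
  opnorm (adjseq T * T) = opnorm T ^+ 2.
Proof.
move=> Tb; have bT := opnorm_bound Tb.
have b2 : opbound (opnorm T ^+ 2) (adjseq T * T).
  by apply: opboundM => //; exact: opbound_adj.
have T2b : adjseq T * T \in bounded_seq by apply/asboolP; eexists; exact: b2.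
apply/eqP; rewrite eq_le opnorm_le //=.
rewrite -[leRHS]sqr_sqrtr ?opnorm_ge0 //.
rewrite ler_pXn2r ?nnegrE ?sqrtr_ge0 ?opnorm_ge0 //.
by apply/opnorm_le/opbound_cstar/opnorm_bound.
Qed.

Lemma adjseqK : involutive adjseq.
Proof. by move=> T; apply: algprod_ext => n; exact: adjmxK. Qed.

Lemma adjseqD S T : adjseq (S + T) = adjseq S + adjseq T.
Proof.
by apply: algprod_ext => n; apply/matrixP => i j; rewrite !mxE rmorphD.
Qed.

Lemma adjseqZ a T : adjseq (a *: T) = a^* *: adjseq T.
Proof.
by apply: algprod_ext => n; apply/matrixP => i j; rewrite !mxE rmorphM.
Qed.

Lemma adjseqM S T : adjseq (S * T) = adjseq T * adjseq S.
Proof.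
apply: algprod_ext => n; rewrite /adjseq !algprodM /adjmx.
by rewrite [(S n * T n)^T]trmx_mul map_mxM.
Qed.

(** A crude estimate, depending on the dimension and on all entries of [v]. It suffices in
    [opnorm_complete], where both are fixed. *)
Lemma ler_vnorm_mulmx n (A : 'M[C]_n) (v : 'cV_n) (e : C) :
    (forall i j, `|A i j| <= e) ->
  vnorm (A *m v) <= e * (n%:R * \sum_j `|v j 0|).
Proof.
move=> Ae; apply: le_trans (ler_vnorm_sum _) _.
have -> : e * (n%:R * \sum_j `|v j 0|) = \sum_(i < n) e * \sum_j `|v j 0|.
  by rewrite sumr_const card_ord -mulrnAr mulr_natl.
apply: ler_sum => i _; rewrite mxE mulr_sumr (le_trans (ler_norm_sum _ _ _)) //.
by apply: ler_sum => j _; rewrite normrM ler_wpM2r.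
Qed.

(** The limit [l] is taken entrywise. For fixed [p] and [v], split [u n - l] at a later [u m]: the
    first part is controlled by the Cauchy condition uniformly in [p], the second is made smaller
    than [eps] by a choice of [m] depending on [p] and [v]. The conclusion is stated with [opbound]
    because it also has to yield that [T] is bounded. *)
Lemma opnorm_complete (u : nat -> matseq) :
    (forall n, u n \in bounded_seq) ->
    (forall e : R, 0 < e -> exists N, forall m n, (N <= m)%N -> (N <= n)%N ->
       opnorm (u m - u n) < e) ->
  exists T, forall e : R, 0 < e -> exists N, forall n, (N <= n)%N ->
    opbound e (u n - T).
Proof.
move=> ub uC.
have uC' (e : R) : 0 < e -> exists N, forall m n, (N <= m)%N -> (N <= n)%N ->
    opbound e (u m - u n).
  move=> /uC[N NP]; exists N => m n Nm Nn.
  have umnb : u m - u n \in bounded_seq.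
    have [_ lin _] := bounded_subalg.
    by rewrite -[u m - u n]addrC -scaleN1r lin.
  have [b0 bP] := opnorm_bound umnb; have lte := NP m n Nm Nn.
  split=> [|p v]; first by rewrite (le_trans b0) // ltW.
  by rewrite (le_trans (bP p v)) // ler_wpM2r ?vnorm_ge0 // lecR ltW.
have entry_cvg p i j : exists l : C, forall e : R, 0 < e ->
    exists N, forall n, (N <= n)%N -> `|u n p i j - l| < e%:C%C.
  apply: complex_cauchy_cvg => e e0.
  have [N NP] := uC' _ (divr_gt0 e0 (ltr0Sn _ 1)).
  exists N => m n Nm Nn; have := ler_entry_opbound i j (NP m n Nm Nn).
  rewrite algprodD algprodN !mxE => /le_lt_trans; apply; rewrite ltcR.
  by rewrite ltr_pdivrMr // ltr_pMr // ltr1n.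
pose l : matseq := fun p => \matrix_(i, j) projT1 (cid (entry_cvg p i j)).
have lP p i j (e : R) : 0 < e ->
    exists N, forall n, (N <= n)%N -> `|u n p i j - l p i j| < e%:C%C.
  by rewrite mxE; case: (cid (entry_cvg p i j)) => /= x; apply.
exists l => e e0; have [N NP] := uC' _ e0; exists N => n Nn.
split=> [|p v]; first exact: ltW.
have [r _ rE] := vnorm_real v.
have [s _ sE] := vnorm_real ((u n - l) p *m v).
rewrite rE sE -rmorphM lecR; apply/ler_addgt0Pr => eps eps0.
(* [k] is the factor from [ler_vnorm_mulmx]. Entries within [eps / (Re k + 1)] of their limits make
   the second part at most [eps]; the added 1 keeps the divisor positive. *)
pose k : C := (d p).+1%:R * \sum_j `|v j 0|.
have k0 : 0 <= k by rewrite mulr_ge0 ?ler0n ?sumr_ge0.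
have kE : (complex.Re k)%:C%C = k by rewrite RRe_real ?ger0_real.
have k1 : 0 < complex.Re k + 1 by rewrite ltr_pwDr // -ler0c kE.
pose f i := choice (fun j => lP p i j _ (divr_gt0 eps0 k1)).
(* An index past [N] and past the thresholds of the finitely many entries of the [p]-th matrix. *)
pose m := maxn N (\max_i \max_j projT1 (f i) j).
have lem i j : (projT1 (f i) j <= m)%N.
  rewrite leq_max; apply/orP; right; apply: leq_trans (leq_bigmax i).
  exact: (leq_bigmax j).
rewrite -lecR rmorphD rmorphM /= -rE -sE.
have -> : (u n - l) p *m v =
    (u n - u m) p *m v + (u m - l) p *m v.
  by rewrite -mulmxDl !algprodD !algprodN addrA subrK.
apply: le_trans (ler_vnormD _ _) _; apply: lerD.
  by apply: (NP n m _ _).2 => //; exact: leq_maxl.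
apply: (@le_trans _ _ ((eps / (complex.Re k + 1))%:C%C * k)).
  apply: ler_vnorm_mulmx => i j; rewrite algprodD algprodN mxE.
  by rewrite [X in _ + X]mxE ltW // (projT2 (f i)).
rewrite -kE -rmorphM lecR mulrAC ler_pdivrMr // ler_wpM2l ?ltW //.
by rewrite ltrDl.
Qed.

End BoundedSequences.

(** * The C*-algebra of bounded sequences of matrices *)

Section BoundedSequencesCStar.
Variables (R : realType) (d : nat -> nat).
Local Notation C := R[i].

Record bmatseq := BMatSeq {
  bmatseq_val :> matseq R d ;
  bmatseqP : bmatseq_val \in @bounded_seq R d }.
HB.instance Definition _ := [isSub for bmatseq_val].
HB.instance Definition _ := [Choice of bmatseq by <:].
HB.instance Definition _ := GRing.SubChoice_isSubAlgebra.Build C (matseq R d)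
  (@bounded_seq R d) bmatseq (GRing.subalg_closed_semi (@bounded_subalg R d)).

Definition bmatseq_adj (T : bmatseq) : bmatseq :=
  BMatSeq (bounded_adjseq (bmatseqP T)).

Fact bmatseq_norm_eq0 (x : bmatseq) : opnorm x = 0 -> x = 0.
Proof.
by move=> x0; apply: val_inj; apply: opnorm0_eq0 x0; exact: bmatseqP.
Qed.

Fact bmatseq_normD (x y : bmatseq) :
  opnorm (x + y : bmatseq) <= opnorm x + opnorm y.
Proof.
by apply/opnorm_le/opboundD; apply: opnorm_bound; exact: bmatseqP.
Qed.

Fact bmatseq_normZ (c : C) (x : bmatseq) :
  opnorm (c *: x : bmatseq) = ComplexField.Normc.normc c * opnorm x.
Proof. exact: opnormZ (bmatseqP x). Qed.

Fact bmatseq_normM (x y : bmatseq) :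
  opnorm (x * y : bmatseq) <= opnorm x * opnorm y.
Proof.
by apply/opnorm_le/opboundM; apply: opnorm_bound; exact: bmatseqP.
Qed.

Fact bmatseq_complete (u : nat -> bmatseq) :
  (forall e : R, 0 < e -> exists N : nat, forall m n : nat,
     (N <= m)%N -> (N <= n)%N -> opnorm (u m - u n : bmatseq) < e) ->
  exists l : bmatseq, forall e : R, 0 < e -> exists N : nat, forall n : nat,
    (N <= n)%N -> opnorm (u n - l : bmatseq) < e.
Proof.
move=> uC.
have [T TP] := opnorm_complete (fun n => bmatseqP (u n)) uC.
have Tb : T \in @bounded_seq R d.
  have [N /(_ N (leqnn _)) NP] := TP 1 ltr01.
  have [_ lin _] := @bounded_subalg R d.
  have -> : T = -1 *: (val (u N) - T) + val (u N).
    by rewrite scaleN1r opprB subrK.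
  by apply: lin; [apply/asboolP; exists 1 | exact: bmatseqP].
(* [opbound] gives only a non-strict inequality; halving [e] makes it strict. *)
exists (BMatSeq Tb) => e e0; have [N NP] := TP _ (divr_gt0 e0 (ltr0Sn _ 1)).
exists N => n /NP/opnorm_le le; apply: le_lt_trans le _.
by rewrite ltr_pdivrMr // ltr_pMr // ltr1n.
Qed.

Fact bmatseq_adjK : involutive bmatseq_adj.
Proof. by move=> x; apply: val_inj; exact: adjseqK. Qed.
Fact bmatseq_adjD : {morph bmatseq_adj : x y / x + y}.
Proof. by move=> x y; apply: val_inj; exact: adjseqD. Qed.
Fact bmatseq_adjZ (c : C) (x : bmatseq) :
  bmatseq_adj (c *: x) = c^* *: bmatseq_adj x.
Proof. by apply: val_inj; exact: adjseqZ. Qed.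
Fact bmatseq_adjM (x y : bmatseq) :
  bmatseq_adj (x * y) = bmatseq_adj y * bmatseq_adj x.
Proof. by apply: val_inj; exact: adjseqM. Qed.
Fact bmatseq_norm_adj (x : bmatseq) :
  opnorm (bmatseq_adj x * x : bmatseq) = opnorm x ^+ 2.
Proof. exact: opnorm_cstar (bmatseqP x). Qed.

HB.instance Definition _ := @isCStarAlgebra.Build R bmatseq
  (fun x => opnorm x) bmatseq_norm_eq0 bmatseq_normD bmatseq_normZ
  bmatseq_normM bmatseq_complete bmatseq_adj bmatseq_adjK bmatseq_adjD
  bmatseq_adjZ bmatseq_adjM bmatseq_norm_adj.

End BoundedSequencesCStar.

(** * Limits along an ultrafilter *)

Section Ultralimits.
Local Open Scope classical_set_scope.

(** By compactness of [[-K, K]] the image of the ultrafilter has a cluster point, and an ultrafilter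
    converges to any of its cluster points: otherwise it would contain the complement of a
    neighbourhood. *)
Lemma ultra_cvg (R : realType) (T : Type) (U : set_system T) (f : T -> R) K :
  UltraFilter U -> (forall x, `|f x| <= K) -> cvg (f @ U).
Proof.
move=> uU fK; have FK : U (f @^-1` `[- K, K]).
  apply: filterE => x /=; rewrite in_itv /= -ler_norml; exact: fK.
have [p [_ clp]] := segment_compact (fmap_proper_filter f ultra_proper) FK.
apply/cvg_ex; exists p => A pA.
have [//|nA] := in_ultra_setVsetC (f @^-1` A) uU.
by have [y []] := clp (~` A) A nA pA.
Qed.

Definition bounded_cseq (R : realType) (f : nat -> R[i]) :=
  exists K : R, forall n, `|f n| <= K%:C%C.

(** Real and imaginary parts of a bounded sequence converge along an ultrafilter refining the
    eventual filter. The refinement gives the last clause, which keeps the moments exact in the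
    limit. *)
Lemma ultralimit (R : realType) : exists L : (nat -> R[i]) -> R[i],
  [/\ forall a f g, bounded_cseq f -> bounded_cseq g ->
        L (fun n => a * f n + g n) = a * L f + L g,
      forall f, bounded_cseq f -> (forall n, 0 <= f n) -> 0 <= L f
    & forall f c N, (forall n, (N <= n)%N -> f n = c) -> L f = c].
Proof.
have [U [uU sU]] := ultraFilterLemma (@eventually_filter).
pose l (f : nat -> R) := lim (f @ U).
have lE f x : f @ U --> x -> l f = x by apply: cvg_lim; exact: Rhausdorff.
have cvRe f : bounded_cseq f -> cvg ((@complex.Re R \o f) @ U).
  move=> [K fK]; apply: (ultra_cvg uU (K := K)) => n; rewrite -lecR.
  apply: le_trans (fK n).
  by rewrite /= normc_def lecR -sqrtr_sqr ler_wsqrtr // lerDl sqr_ge0.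
have cvIm f : bounded_cseq f -> cvg ((@complex.Im R \o f) @ U).
  move=> [K fK]; apply: (ultra_cvg uU (K := K)) => n; rewrite -lecR.
  apply: le_trans (fK n).
  by rewrite /= normc_def lecR -sqrtr_sqr ler_wsqrtr // lerDr sqr_ge0.
have lin (a b : R) f g h : cvg (f @ U) -> cvg (g @ U) -> cvg (h @ U) ->
    l (fun n => a * f n + b * g n + h n) = a * l f + b * l g + l h.
  move=> cf cg ch; apply: lE; apply: cvgD ch; apply: cvgD; apply: cvgM => //;
  exact: cvg_cst.
exists (fun f => l (@complex.Re R \o f) +i* l (@complex.Im R \o f))%C; split.
- move=> [a b] f g bf bg.
  have [[[cRf cIf] cRg] cIg] := (cvRe f bf, cvIm f bf, cvRe g bg, cvIm g bg).
  have -> : @complex.Re R \o (fun n => (a +i* b)%C * f n + g n) =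
      fun n => a * (@complex.Re R \o f) n + (- b) * (@complex.Im R \o f) n
               + (@complex.Re R \o g) n.
    by apply/funext => n /=; case: (f n) (g n) => ? ? [? ?] /=; rewrite mulNr.
  have -> : @complex.Im R \o (fun n => (a +i* b)%C * f n + g n) =
      fun n => a * (@complex.Im R \o f) n + b * (@complex.Re R \o f) n
               + (@complex.Im R \o g) n.
    apply/funext => n /=; case: (f n) (g n) => ? ? [? ?] /=.
    by congr (_ + _ + _); rewrite mulrC.
  by rewrite !lin // mulNr; simpc.
- move=> f bf f0; rewrite lecE /=; apply/andP; split; last first.
    apply: limr_ge; first exact: cvRe.
    by apply: filterE => n /=; move: (f0 n); rewrite lecE => /andP[].
  rewrite (lE _ 0) //; apply: cvg_near_cst; apply: filterE => n /=.
  by move: (f0 n); rewrite lecE => /andP[/eqP].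
- move=> f c N fc.
  have UN (P : nat -> Prop) : (forall n, (N <= n)%N -> P n) -> U P.
    by move=> NP; apply: sU; exists N.
  rewrite (lE _ (complex.Re c)) 1?(lE _ (complex.Im c)); first by case: (c).
    by apply: cvg_near_cst; apply: UN => n /fc /= ->.
  by apply: cvg_near_cst; apply: UN => n /fc /= ->.
Qed.

End Ultralimits.

(** * Moments of bounded symmetric operators *)

(** The state is the ultralimit of the vector states given by the unit vectors [c n]. Cauchy-Schwarz
    bounds each sequence of values by [opnorm T]. *)
Lemma bmatseq_state (R : realType) (d : nat -> nat)
    (c : forall n, 'cV[R[i]]_((d n).+1)) :
    (forall n, vdot (c n) (c n) = 1) ->
  exists phi : {scalar bmatseq R d}, cstar_state phi /\
    forall (T : bmatseq R d) z N,
      (forall n, (N <= n)%N -> vdot (val T n *m c n) (c n) = z) -> phi T = z.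
Proof.
move=> c1; have [L [L_linear L_ge0 L_eq]] := ultralimit R.
pose z (T : bmatseq R d) n : R[i] := vdot (val T n *m c n) (c n).
have z_bounded T : bounded_cseq (z T).
  have [K0 KT] := opnorm_bound (bmatseqP T); exists (opnorm T) => n.
  have n1 : vnorm (c n) = 1 by rewrite /vnorm /seminorm c1 sqrtC1.
  have := KT n (c n); rewrite n1 mulr1; apply: le_trans.
  have := ler_norm_dot vdotP (val T n *m c n) (c n).
  by rewrite -!/(vnorm _) n1 mulr1.
pose phi T := L (z T).
have phi_linear : scalar phi.
  move=> a S T; rewrite /phi -L_linear //; congr L; apply/funext => n.
  rewrite /z -(dot_linear vdotP) scalemxAl -mulmxDl; congr (vdot (_ *m _) _).
pose phil : {scalar bmatseq R d} := HB.pack phi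
  (GRing.isLinear.Build R[i] (bmatseq R d) R[i] *%R phi phi_linear).
exists phil; split=> [|T x N NP]; last exact: L_eq NP.
split=> [T|].
  apply: L_ge0 => // n; rewrite /z -[val (star T * T) n]
    /(adjmx (val T n) *m val T n) -mulmxA.
  by rewrite vdot_adj adjmxK; exact: dot_ge0 vdotP _.
by apply: (L_eq _ _ 0%N) => n _; rewrite /z mul1mx c1.
Qed.

(** * Finite frames and compressions of symmetric operators *)

Section Frames.
Variables (R : realType) (V : lmodType R[i]) (dot : V -> V -> R[i]).
Hypothesis dotP : semi_inner dot.
Local Notation C := R[i].

Lemma finite_frame (s : seq V) : exists (n : nat) (e : 'I_n.+1 -> V),
  (forall w, w \in s -> forall u, dot w u = \sum_a dot w (e a) * dot (e a) u) /\
  (forall v, \sum_a `|dot v (e a)| ^+ 2 <= dot v v).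
Proof.
have [es [sP eP]] := gram_schmidt dotP s.
(* The zero vector in front makes the index type nonempty, as the ring of square matrices requires;
   it contributes nothing to either sum. *)
exists (size es), (fun a => nth 0 (0 :: es) a); split=> [w ws u|v].
  rewrite (sP w ws u) -(big_mkord predT (fun a => dot w (nth 0 (0 :: es) a) *
    dot (nth 0 (0 :: es) a) u)) big_nat_recl //= dot0r // mul0r add0r.
  by rewrite [LHS](big_nth 0).
apply: le_trans (bessel dotP v eP).
rewrite -(big_mkord predT (fun a => `|dot v (nth 0 (0 :: es) a)| ^+ 2)).
rewrite big_nat_recl //= dot0r // normr0 expr0n add0r.
by rewrite [leRHS](big_nth 0).
Qed.

Variables (n : nat) (e : 'I_n -> V).
Hypothesis e_bessel : forall v, \sum_a `|dot v (e a)| ^+ 2 <= dot v v.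

Definition coord (v : V) : 'cV[C]_n := \col_a dot v (e a).

Lemma vnorm_coord v : vnorm (coord v) ^+ 2 <= dot v v.
Proof.
rewrite seminorm_sqr /vdot; under eq_bigr do rewrite !mxE -normCK.
exact: e_bessel.
Qed.

Definition synthesis (c : 'cV[C]_n) : V := \sum_a c a 0 *: e a.

(** [synthesis] is adjoint to the contraction [coord], so it contracts too:
    [dot q q = vdot c (coord q)], to which Cauchy-Schwarz and [vnorm_coord] apply, and a factor
    [dot q q] cancels. *)
Lemma synthesis_bound c : dot (synthesis c) (synthesis c) <= vnorm c ^+ 2.
Proof.
set q := synthesis c; have qE : dot q q = vdot c (coord q).
  rewrite {1}/q dot_suml //; apply: eq_bigr => a _.
  by rewrite dotZl // mxE -(dotC dotP).
have q0 : 0 <= dot q q by exact: dot_ge0.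
have [->|qN] := eqVneq (dot q q) 0; first by rewrite exprn_ge0 ?vnorm_ge0.
have qP : 0 < dot q q by rewrite lt_def qN.
rewrite -(ler_pM2r qP).
apply: le_trans (_ : vnorm c ^+ 2 * vnorm (coord q) ^+ 2 <= _).
  rewrite -exprMn -expr2 ler_pXn2r ?nnegrE ?mulr_ge0 ?vnorm_ge0 //.
  by rewrite -[leLHS](ger0_norm q0) qE; exact: ler_norm_dot vdotP _ _.
by rewrite ler_wpM2l ?exprn_ge0 ?vnorm_ge0 // vnorm_coord.
Qed.

Variables (T : V -> V).
Hypothesis T_sym : forall u v, dot (T u) v = dot u (T v).

(** The matrix of [synthesis] followed by [T] and then [coord]. *)
Definition compression : 'M[C]_n := \matrix_(a, b) dot (T (e b)) (e a).

Lemma adj_compression : adjmx compression = compression.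
Proof. by apply/matrixP => a b; rewrite !mxE -(dotC dotP) T_sym. Qed.

(** [coord] and [synthesis] are contractions. The bound depends on [K] alone and not on the frame,
    so the compressions to all frames form a bounded sequence. *)
Lemma compression_bound (K : R) (c : 'cV[C]_n) :
    0 <= K -> (forall u, dot (T u) (T u) <= K%:C%C * dot u u) ->
  vnorm (compression *m c) <= (Num.sqrt K)%:C%C * vnorm c.
Proof.
move=> K0 KT; set q := synthesis c.
have -> : compression *m c = coord (T q).
  apply/colP => a; rewrite !mxE T_sym dot_suml //; apply: eq_bigr => b _.
  by rewrite !mxE dotZl // T_sym mulrC.
rewrite -(ler_pXn2r (n := 2)) ?nnegrE ?mulr_ge0 ?vnorm_ge0 ?ler0c ?sqrtr_ge0 //.
rewrite (le_trans (vnorm_coord _)) // (le_trans (KT _)) //.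
rewrite exprMn -rmorphXn sqr_sqrtr // ler_wpM2l ?ler0c //.
exact: synthesis_bound.
Qed.

(** By symmetry the entries of [coord (T v)] are [dot v (T (e a))], so only [v] has to be resolved
    by the frame, not [T v]. *)
Lemma compression_coord v :
    (forall u, dot v u = \sum_a dot v (e a) * dot (e a) u) ->
  compression *m coord v = coord (T v).
Proof.
move=> vE; apply/colP => a; rewrite !mxE T_sym vE; apply: eq_bigr => b _.
by rewrite !mxE T_sym mulrC.
Qed.

Lemma vdot_coord u v :
    (forall u, dot v u = \sum_a dot v (e a) * dot (e a) u) ->
  vdot (coord v) (coord u) = dot v u.
Proof.
by move=> ->; apply: eq_bigr => a _; rewrite !mxE -(dotC dotP).
Qed.

End Frames.

(** * Realising vacuum moments in a C*-probability space *)

Section SymmetricOperators.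
Variables (R : realType) (k : nat) (V : lmodType R[i]) (dot : V -> V -> R[i]).
Variables (T : 'I_k -> V -> V) (omega : V).
Hypotheses (dotP : semi_inner dot) (omega1 : dot omega omega = 1).
Hypothesis T_sym : forall i u v, dot (T i u) v = dot u (T i v).
Hypothesis T_bounded : forall i, exists2 K : R, 0 <= K &
  forall u, dot (T i u) (T i u) <= K%:C%C * dot u u.

Fixpoint word_vectors N : seq V :=
  if N is N'.+1 then
    word_vectors N' ++ [seq T i v | i <- enum 'I_k, v <- word_vectors N']
  else [:: omega].

Lemma mem_word_vectors w N : (size w <= N)%N ->
  foldr T omega w \in word_vectors N.
Proof.
elim: N w => [|N IHN] [|i w] //= ltwN; first by rewrite mem_head.
  by rewrite mem_cat (IHN [::]).
by rewrite mem_cat; apply/orP; right; apply: allpairs_f; rewrite ?mem_enum ?IHN.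
Qed.

Lemma Dc_symmetric (mu : Dalg R k) :
    (forall w, (1 + Mseries mu) w = dot (foldr T omega w) omega) ->
  Dc mu.
Proof.
move=> muE.
pose fr N := cid (finite_frame dotP (word_vectors N)).
pose d N := projT1 (fr N).
pose e N : 'I_(d N).+1 -> V := projT1 (cid (projT2 (fr N))).
have eP N : (forall w, w \in word_vectors N -> forall u,
      dot w u = \sum_a dot w (e N a) * dot (e N a) u) /\
    (forall v, \sum_a `|dot v (e N a)| ^+ 2 <= dot v v).
  exact: projT2 (cid (projT2 (fr N))).
pose Y i : matseq R d := fun N => compression dot (e N) (T i).
have Yb i : Y i \in @bounded_seq R d.
  have [K K0 KT] := T_bounded i; apply/asboolP; exists (Num.sqrt K).
  split=> [|N v]; first exact: sqrtr_ge0.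
  apply: compression_bound => //; exact: (eP N).2.
pose y i := BMatSeq (Yb i).
pose c N := coord dot (e N) omega.
(* Each compression step acts on a vector [foldr T omega v] with [v] a proper suffix of [w]. The
   [N]-th frame resolves these, so nothing is lost. *)
have wE w N : (size w <= N)%N ->
    val (\prod_(i <- w) y i) N *m c N = coord dot (e N) (foldr T omega w).
  elim: w => [|i w IHw] ltwN; first by rewrite big_nil mul1mx.
  rewrite big_cons -[val _ N]/(Y i N *m val (\prod_(j <- w) y j) N) -mulmxA.
  rewrite IHw 1?ltnW // compression_coord //=.
  by apply: (eP N).1; rewrite mem_word_vectors // ltnW.
have vE w N : (size w <= N)%N ->
    vdot (val (\prod_(i <- w) y i) N *m c N) (c N) =
    dot (foldr T omega w) omega.
  move=> ltwN; rewrite wE // vdot_coord //.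
  by apply: (eP N).1; exact: mem_word_vectors.
have c1 N : vdot (c N) (c N) = 1.
  by have := vE [::] N isT; rewrite big_nil mul1mx /= omega1.
have [phi [phi_state phiE]] := bmatseq_state c1.
exists (bmatseq R d), phi, y; split=> // [i|w].
  by apply: val_inj; apply: algprod_ext => N; exact: adj_compression.
by rewrite -Mseries1 muE; apply/esym/(phiE _ _ (size w)) => N; exact: vE.
Qed.

End SymmetricOperators.

(** * Square roots in C*-algebras *)

Section CStarSquareRoot.
Variables (R : realType) (A : cstarAlgType R).
Implicit Types x y h : A.
Local Notation nrm := (@cnorm R A).

Lemma cnorm0 : nrm 0 = 0.
Proof.
by rewrite -(scale0r (0 : A)) cnormZ ComplexField.Normc.normc0 mul0r.
Qed.

Lemma cnormZ_real (a : R) x : 0 <= a -> nrm (a%:C%C *: x) = a * nrm x.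
Proof.
by move=> a0; rewrite cnormZ /= expr0n addr0 sqrtr_sqr ger0_norm.
Qed.

Lemma cnormN x : nrm (- x) = nrm x.
Proof.
rewrite -scaleN1r cnormZ.
rewrite -[ComplexField.Normc.normc _]/(complex.Re `|-1 : R[i]|).
by rewrite normrN1 mul1r.
Qed.

Lemma cnorm_ge0 x : 0 <= nrm x.
Proof.
have := ler_cnormD x (- x); rewrite subrr cnorm0 cnormN -mulr2n.
by rewrite pmulrn_lge0.
Qed.

(** [|y|^2 = |y^* y| <= |y^*| * |y|] gives one inequality for every [y]; apply it to [x] and to
    [star x]. *)
Lemma cnorm_star_eq x : nrm (star x) = nrm x.
Proof.
have le y : nrm y <= nrm (star y).
  have [->|y0] := eqVneq (nrm y) 0; first exact: cnorm_ge0.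
  have yP : 0 < nrm y by rewrite lt_def y0 cnorm_ge0.
  by rewrite -(ler_pM2r yP) -expr2 -cnorm_star ler_cnormM.
by apply/eqP; rewrite eq_le le andbT -{2}(starK x) le.
Qed.

Lemma star0 : star (0 : A) = 0.
Proof. by apply: (addrI (star (0 : A))); rewrite -starD !addr0. Qed.

Lemma starB x y : star (x - y) = star x - star y.
Proof.
rewrite starD; congr (_ + _); apply: (addrI (star y)).
by rewrite -starD !subrr star0.
Qed.

Lemma star1 : star (1 : A) = 1.
Proof. by rewrite -[LHS]mulr1 -{2}(starK 1) -starM mulr1 starK. Qed.

Lemma cnorm_subsqr x y (r s : R) : nrm x <= r -> nrm y <= s ->
  nrm (x * x - y * y) <= (r + s) * nrm (x - y).
Proof.
move=> xr ys; have -> : x * x - y * y = x * (x - y) + (x - y) * y.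
  by rewrite mulrBr mulrBl addrA subrK.
rewrite (le_trans (ler_cnormD _ _)) // [leRHS]mulrDl lerD //.
  by rewrite (le_trans (ler_cnormM _ _)) // ler_wpM2r ?cnorm_ge0.
by rewrite (le_trans (ler_cnormM _ _)) // mulrC ler_wpM2r ?cnorm_ge0.
Qed.

(* With s = 1 - t the equation s^2 = 1 - h reads t = (h + t^2) / 2, whose right
   hand side maps the ball of radius |h| to itself, with Lipschitz constant
   |h|. *)
Lemma cstar_sqrt h : star h = h -> nrm h < 1 ->
  exists s : A, star s = s /\ s * s = 1 - h.
Proof.
move=> hh h1; set r := nrm h; have r0 : 0 <= r by exact: cnorm_ge0.
pose half : R[i] := (2^-1 : R)%:C%C.
have h0 : 0 <= 2^-1 :> R by rewrite invr_ge0 ler0n.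
pose F (t : A) := half *: (h + t * t).
have F_ball t : nrm t <= r -> nrm (F t) <= r.
  move=> tr; rewrite cnormZ_real // ler_pdivrMl // mulr_natl mulr2n.
  rewrite (le_trans (ler_cnormD _ _)) // lerD2l (le_trans (ler_cnormM _ _)) //.
  rewrite -[r]mulr1 ler_pM ?cnorm_ge0 // (le_trans tr) //; exact: ltW.
(* The two radii differ so that this also applies to the limit [l], with [s = nrm l]. For [s = r]
   the Lipschitz constant is [r]. *)
have F_lip t u s : nrm t <= r -> nrm u <= s ->
    nrm (F t - F u) <= (r + s) / 2 * nrm (t - u).
  move=> tr us; rewrite -scalerBr opprD addrACA subrr add0r cnormZ_real //.
  by rewrite mulrAC [_ / 2]mulrC ler_wpM2l // cnorm_subsqr.
pose t n := iter n F 0.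
have t_ball n : nrm (t n) <= r.
  by elim: n => [|n IHn]; [rewrite cnorm0 | exact: F_ball].
have t_cauchy n p : nrm (t (n + p)%N - t n) <= r ^+ n.
  elim: n => [|n IHn]; first by rewrite subr0 (le_trans (t_ball _)) // ltW.
  apply: le_trans (F_lip _ _ r (t_ball _) (t_ball _)) _.
  by rewrite exprS mulrDl -splitr ler_wpM2l.
have r_small (e : R) : 0 < e -> exists N, forall n, (N <= n)%N -> r ^+ n < e.
  have r_cvg : (r ^+ n @[n --> \oo] --> (0 : R))%classic.
    by apply: cvg_expr; rewrite ger0_norm.
  move=> e0; have /cvgr0Pnorm_lt/(_ e e0)[N _ NP] := r_cvg.
  by exists N => n /NP; rewrite ger0_norm ?exprn_ge0.
have [l lP] : exists l, forall e : R, 0 < e -> exists N, forall n, (N <= n)%N ->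
    nrm (t n - l) < e.
  apply: cnorm_complete => e e0; have [N NP] := r_small _ e0.
  have le m n : (N <= m)%N -> (N <= n)%N -> (n <= m)%N -> nrm (t m - t n) < e.
    by move=> _ /NP le_n /subnKC <-; exact: le_lt_trans (t_cauchy _ _) le_n.
  exists N => m n Nm Nn; have [nm|mn] := leqP n m; first exact: le.
  by rewrite -cnormN opprB le // ltnW.
(* This replaces continuity of [F] and of [star]: it is applied to [l - F l] and to [star l - l]. *)
have small_eq0 x (K : R) : 0 <= K ->
    (forall n, nrm x <= nrm (t n.+1 - l) + K * nrm (t n - l)) -> x = 0.
  move=> K0 xP; apply: cnorm_eq0; apply/eqP; rewrite eq_le cnorm_ge0 andbT.
  apply/ler_addgt0Pr => e e0; rewrite add0r.
  have K1 : 0 < 1 + K by rewrite ltr_pwDl.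
  have [N NP] := lP _ (divr_gt0 e0 K1); apply: le_trans (xP N) _.
  have eK : (1 + K) * (e / (1 + K)) = e by rewrite mulrC divfK // gt_eqF.
  rewrite -[leRHS]eK [leRHS]mulrDl mul1r.
  by apply: lerD; [|apply: ler_wpM2l => //]; rewrite ltW // NP // leqnSn.
have lE : l = F l.
  apply/eqP; rewrite -subr_eq0; apply/eqP.
  apply: (small_eq0 _ ((r + nrm l) / 2)) => [|n].
    by rewrite divr_ge0 ?addr_ge0 ?cnorm_ge0.
  rewrite -[l - F l](subrKA (t n.+1)) (le_trans (ler_cnormD _ _)) //.
  by rewrite -[nrm (l - _)]cnormN opprB lerD2l F_lip.
have t_star n : star (t n) = t n.
  elim: n => [|n IHn]; first exact: star0.
  by rewrite /= starZ starD starM hh IHn conj_Creal // ?complex_real.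
have l_star : star l = l.
  apply/eqP; rewrite -subr_eq0; apply/eqP.
  apply: (small_eq0 _ 2) => // n; rewrite ler_wpDl ?cnorm_ge0 //.
  rewrite -[star l - l](subrKA (t n)) (le_trans (ler_cnormD _ _)) //.
  rewrite -{1}[t n]t_star -starB cnorm_star_eq -cnormN opprB.
  by rewrite -mulr2n mulr_natl.
exists (1 - l); split; first by rewrite starB star1 l_star.
have l2 : l + l = h + l * l.
  rewrite {1 2}lE /F -scalerDl (_ : half + half = 1) ?scale1r //.
  by rewrite -rmorphD -[2^-1]mul1r -splitr.
have -> : h = l + l - l * l by rewrite l2 addrK.
rewrite mulrBl mul1r mulrBr mulr1 !opprB opprD -addrA; congr (_ + _).
exact: addrCA.
Qed.

End CStarSquareRoot.

(** * Boolean Fock space *)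

Section PositiveFunctional.
Variables (R : realType) (A : cstarAlgType R) (phi : {scalar A}).
Hypothesis phi_ge0 : positive_functional phi.

Definition gns_dot (a b : A) : R[i] := phi (star b * a).

(** Polarisation: [c *: a + c^* *: star a] is a combination of elements [star y * y] with real
    coefficients, so [phi] is real on it. The cases [c = 1] and [c = 'i] together determine
    [phi (star a)]. *)
Lemma positive_functional_star a : phi (star a) = (phi a)^*.
Proof.
have real c : (phi (c *: a + c^* *: star a))^* = phi (c *: a + c^* *: star a).
  have -> : c *: a + c^* *: star a = star (1 + c *: a) * (1 + c *: a) - 1
      - star (c *: a) * (c *: a).
    rewrite starD star1 starZ mulrDl !mulrDr !mul1r mulr1.
    by rewrite addrAC !addrA addrK -[1 + _ + _]addrA [1 + _]addrC addrK.
  have sq y : (phi (star y * y))^* = phi (star y * y).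
    by apply: conj_Creal; apply: ger0_real; exact: phi_ge0.
  have one : (phi 1)^* = phi 1 by rewrite -[1]mul1r -{1 3}star1 sq.
  by rewrite !linearB /= !rmorphB /= !sq one.
have := real 'i; have := real 1.
rewrite !linearD !linearZ /= !rmorphD !rmorphM /= !conjCK conjCi rmorph1 !mul1r.
move: (phi a) (phi (star a)) => z w e1 e2.
have {}e2 : w^* - z^* = z - w.
  apply: (mulfI (neq0Ci _)); rewrite !mulrBr -mulNr -[- ('i * w)]mulNr -e2.
  by rewrite addrC.
rewrite -[LHS]conjCK; congr (_^*); apply: (mulfI (_ : 2%:R != 0)).
  by rewrite pnatr_eq0.
have -> : 2 * w^* = (z^* + w^*) + (w^* - z^*) by ring.
by rewrite e1 e2; ring.
Qed.

Lemma gns_dotP : semi_inner gns_dot.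
Proof.
split=> [c u v w|u v|u]; last exact: phi_ge0.
  by rewrite /gns_dot mulrDr -scalerAr linearP.
by rewrite /gns_dot -positive_functional_star starM starK.
Qed.

(** With [K = |x|^2 + 1] the element [h = K^-1 x^* x] has norm below 1, so [1 - h = s^2] with [s]
    selfadjoint. Positivity of [phi] at [s * b] then gives [phi (b^* h b) <= phi (b^* b)]. *)
Lemma gns_mul_bounded x : exists2 K : R, 0 <= K &
  forall b, gns_dot (x * b) (x * b) <= K%:C%C * gns_dot b b.
Proof.
pose K := cnorm x ^+ 2 + 1; have K0 : 0 < K by rewrite ltr_wpDl ?sqr_ge0.
exists K => [|b]; first exact: ltW.
pose h := (K^-1)%:C%C *: (star x * x).
have [||s [ss s2]] := @cstar_sqrt _ _ h.
- by rewrite starZ starM starK conj_Creal // complex_real.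
- rewrite cnormZ_real ?invr_ge0 ?ltW // cnorm_star.
  by rewrite ltr_pdivrMl // mulr1 ltrDl.
have := phi_ge0 (s * b); rewrite starM ss -mulrA [s * (s * b)]mulrA s2.
rewrite mulrBl mul1r mulrBr linearB /= subr_ge0 -scalerAl -scalerAr linearZ /=.
rewrite /gns_dot starM -!mulrA fmorphV /= => le.
by rewrite -ler_pdivrMl ?ltcR.
Qed.

End PositiveFunctional.

(** * The symmetric operators on the Fock space *)

Section BooleanFock.
Variables (R : realType) (k : nat) (A : cstarAlgType R) (phi : {scalar A}).
Variable x : 'I_k -> A.
Hypotheses (phi_state : cstar_state phi) (x_sa : forall i, selfadjoint (x i)).
Local Notation C := R[i].
Local Notation dotA := (gns_dot phi).

Definition fock : lmodType C := (C^o * {ffun 'I_k -> A})%type.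

Definition fock_dot (u v : fock) : C :=
  u.1 * v.1^* + \sum_i dotA (u.2 i) (v.2 i).

Definition vacuum : fock := (1, 0).

Definition fock_op (j : 'I_k) (u : fock) : fock :=
  (phi (u.2 j), [ffun i => x j * u.2 i + (j == i)%:R * u.1 *: 1]).

Let dotAP : semi_inner dotA. Proof. exact: gns_dotP phi_state.1. Qed.

Lemma fock_dotP : semi_inner fock_dot.
Proof.
split=> [c u v w|u v|u].
- rewrite /fock_dot /= mulrDr mulr_sumr mulrDl addrACA -big_split /=.
  rewrite -mulrA; congr (_ + _); apply: eq_bigr => i _.
  by rewrite !ffunE (dot_linear dotAP).
- rewrite /fock_dot rmorphD rmorphM /= conjCK mulrC rmorph_sum; congr (_ + _).
  by apply: eq_bigr => i _; rewrite (dotC dotAP).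
- rewrite addr_ge0 ?mul_conjC_ge0 // sumr_ge0 // => i _; exact: dot_ge0 dotAP _.
Qed.

Lemma fock_dot_vacuum u : fock_dot u vacuum = u.1.
Proof.
rewrite /fock_dot /= rmorph1 mulr1 big1 ?addr0 // => i _.
by rewrite ffunE dot0r.
Qed.

Lemma gns_dot1r b : dotA b 1 = phi b.
Proof. by rewrite /gns_dot star1 mul1r. Qed.

Lemma gns_dot1l b : dotA 1 b = (phi b)^*.
Proof. by rewrite (dotC dotAP) gns_dot1r. Qed.

(** Left multiplication by [x j] is symmetric in each slot, while the annihilation part
    [phi (u.2 j)] and the creation part in slot [j] are adjoint to each other because
    [phi b = dotA b 1]. *)
Lemma fock_op_sym j u v : fock_dot (fock_op j u) v = fock_dot u (fock_op j v).
Proof.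
rewrite /fock_dot /=.
have xE a b : dotA (x j * a) b = dotA a (x j * b).
  by rewrite /gns_dot starM (x_sa j : star (x j) = x j) mulrA.
under eq_bigr do rewrite ffunE dotDl // dotZl // xE gns_dot1l.
under [in RHS]eq_bigr do rewrite ffunE dotDr // dotZr // gns_dot1r.
have delta (F : 'I_k -> C) : \sum_i (j == i)%:R * F i = F j.
  rewrite (bigD1 j) //= eqxx mul1r big1 ?addr0 // => i ij.
  by rewrite eq_sym (negbTE ij) mul0r.
rewrite !big_split /=.
have -> : \sum_i (j == i)%:R * u.1 * (phi (v.2 i))^* = u.1 * (phi (v.2 j))^*.
  rewrite -(delta (fun i => u.1 * (phi (v.2 i))^*)).
  by apply: eq_bigr => i _; rewrite mulrA.
have -> : \sum_i ((j == i)%:R * v.1)^* * phi (u.2 i) = phi (u.2 j) * v.1^*.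
  rewrite mulrC -(delta (fun i => v.1^* * phi (u.2 i))).
  apply: eq_bigr => i _.
  by rewrite rmorphM rmorph_nat mulrA.
by rewrite addrCA [RHS]addrCA [X in _ + X]addrC.
Qed.

(** Cauchy-Schwarz against 1 bounds the vacuum component by [S], and [dotDD_le] bounds the other
    slots by [2 * (K * S + c)]. The sum is at most [(2 * K + 2) * (c + S)]. *)
Lemma fock_op_bounded j : exists2 K : R, 0 <= K &
  forall u, fock_dot (fock_op j u) (fock_op j u) <= K%:C%C * fock_dot u u.
Proof.
have [K K0 KP] := gns_mul_bounded phi_state.1 (x j).
exists (2 * K + 2) => [|u]; first by rewrite addr_ge0 ?mulr_ge0.
set S := \sum_i dotA (u.2 i) (u.2 i); set c := u.1 * u.1^*.
have dot_nneg b : 0 <= dotA b b by exact: dot_ge0 dotAP _.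
have S0 : 0 <= S by exact: sumr_ge0.
have c0 : 0 <= c by exact: mul_conjC_ge0.
have phi_le : phi (u.2 j) * (phi (u.2 j))^* <= S.
  have := cauchy_schwarz dotAP (u.2 j) 1.
  rewrite gns_dot1r gns_dot1r phi_state.2 mulr1 normCK => /le_trans; apply.
  by rewrite /S (bigD1 j) //= lerDl sumr_ge0.
have sum_le : \sum_i dotA ((fock_op j u).2 i) ((fock_op j u).2 i) <=
    2 * (K%:C%C * S + c).
  have -> : c = \sum_i (j == i)%:R * c.
    rewrite (bigD1 j) //= eqxx mul1r big1 ?addr0 // => i ij.
    by rewrite eq_sym (negbTE ij) mul0r.
  rewrite mulr_sumr -big_split mulr_sumr; apply: ler_sum => i _.
  rewrite ffunE (le_trans (dotDD_le dotAP _ _)) // ler_wpM2l // lerD //.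
  rewrite dotZl // dotZr // gns_dot1r phi_state.2 mulr1.
  by case: eqP => _; rewrite ?mul0r // !mul1r.
apply: le_trans (lerD phi_le sum_le) _; rewrite -/S -/c -subr_ge0.
rewrite rmorphD rmorphM /= rmorph_nat.
have -> : (2 * K%:C%C + 2) * (c + S) - (S + 2 * (K%:C%C * S + c)) =
  2 * K%:C%C * c + S by ring.
by rewrite addr_ge0 // mulr_ge0 // mulr_ge0 ?ler0n ?ler0c.
Qed.

End BooleanFock.

(** * The series of vacuum moments and its fixed-point equation *)

Lemma ncvarM_nil (I : eqType) (K : fieldType) (i : I) (f : ncseries I K) :
  (ncvar K i * f) [::] = 0.
Proof. by rewrite ncseriesM_nil mul0r. Qed.

Lemma ncvarM_cons (I : eqType) (K : fieldType) (i j : I) (f : ncseries I K) w :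
  (ncvar K i * f) (j :: w) = (j == i)%:R * f w.
Proof.
rewrite [LHS]nc_mul_cons mul0r add0r -nc_constM; congr (nc_mul _ _ _).
apply/funext => -[|l v]; rewrite /nc_shift /ncvar /= eqseq_cons ?andbT //.
by rewrite andbF.
Qed.

Section Moments.
Variables (R : realType) (k : nat) (A : cstarAlgType R) (phi : {scalar A}).
Variable x : 'I_k -> A.
Local Notation C := R[i].

Let b w i := (foldr (fock_op phi x) (vacuum k A) w).2 i.
Definition fock_moment : ncseries 'I_k C :=
  fun w => (foldr (fock_op phi x) (vacuum k A) w).1.

(* First-return decomposition: the component of [T_w vacuum] at [i] collects the
   words [w = u i v], where [v] leads from the vacuum back to the vacuum. *)
Lemma fock_component (f : ncseries 'I_k C) a i w :
    (forall u, f u = phi (a * \prod_(j <- u) x j)) ->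
  phi (a * b w i) = (f * (ncvar C i * fock_moment)) w.
Proof.
(* [f] and [a] vary in the induction: a letter [j] read from the word is absorbed into [a * x j],
   and [f] becomes its shift by [j]. The creation part of [T_j] supplies the term of the product
   where [u] is empty. *)
elim: w f a => [|j w IHw] f a fE.
  by rewrite ncseriesM_nil ncvarM_nil mulr0 /b /= ffunE mulr0 linear0.
rewrite [RHS]nc_mul_cons ncvarM_cons (fE [::]) big_nil mulr1.
rewrite /b /= ffunE mulrDr linearD /= mulrA addrC; congr (_ + _).
  by rewrite -scalerAr mulr1 linearZ /= mulrC.
by apply: IHw => u; rewrite /nc_shift fE big_cons mulrA.
Qed.

End Moments.

(** Both sides are right inverses of [1 - eta (Phi nu)]. For the moments [m] this is
    [m = 1 + Phi_series nu * m], checked on the first letter of a word. *)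
Lemma Phi_moment (R : realType) (k : nat) (A : cstarAlgType R)
    (phi : {scalar A}) (x : 'I_k -> A) (nu : Dalg R k) :
    is_joint_distribution phi x nu ->
  1 + Mseries (Phi nu) = fock_moment phi x.
Proof.
move=> nuE; set m := fock_moment phi x.
have u : 1 - eta (Phi nu) \is a GRing.unit.
  by rewrite ncseries_unitE ncseriesD ncseriesN eta_nil subr0 oner_eq0.
apply: (mulrI u); rewrite eta_Mseries eta_Phi mulrBl mul1r.
suff mE : m = 1 + Phi_series nu * m by rewrite {1}mE addrK.
apply/funext => -[|i w]; rewrite ncseriesD ncseries1 /=.
  by rewrite ncseriesM_nil Phi_series_nil mul0r addr0.
rewrite add0r [RHS]nc_mul_cons Phi_series_nil mul0r add0r.
(* Removing a leading [i] selects the [i]-th summand. On the operator side, the vacuum component of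
   [T_i] is [phi] of slot [i], so [fock_component] with [a = 1] computes it. *)
have -> : nc_shift i (Phi_series nu) = (1 + Mseries nu) * ncvar _ i.
  apply/funext => v; rewrite /nc_shift /Phi_series ncseries_sum (bigD1 i) //=.
  rewrite -mulrA ncvarM_cons eqxx mul1r big1 ?addr0 // => j ji.
  by rewrite -mulrA ncvarM_cons eq_sym (negbTE ji) mul0r.
rewrite -[RHS]/(((1 + Mseries nu) * ncvar _ i * m) w) -mulrA.
rewrite -(fock_component (a := 1)) ?mul1r // => v.
by rewrite mul1r Mseries1 nuE.
Qed.

Theorem corollary7p10 (R : realType) (k : nat) (hk : (1 <= k)%N)
  (nu : Dalg R k) (hnu : Dc nu) : Dc (Phi nu).
Proof.
have [A [phi [x [phi_state x_sa nuE]]]] := hnu.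
apply: (@Dc_symmetric _ _ _ (fock_dot phi) (fock_op phi x) (vacuum k A)).
- exact: fock_dotP.
- by rewrite fock_dot_vacuum.
- exact: fock_op_sym.
- exact: fock_op_bounded.
- by move=> w; rewrite (Phi_moment nuE) fock_dot_vacuum.
Qed.
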